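(* Let $b\colon\mathbb{R}^d\times[0,T]\to\mathbb{R}^d$ be continuous. Suppose that there exist a sequence of vector fields $b_k\in C^\infty(\mathbb{R}^d\times\mathbb{R}^1,\mathbb{R}^d)$ and a sequence of positive functions $V_k\in C^1(\mathbb{R}^d)$ such that (i) there exist numbers $C_1$, $C_2$ and $C_3$ such that $V_k\le C_1V_m+C_2$ for all $k\le m$, and $$\langle b_k(x,t),\nabla V_k(x)\rangle\le C_3V_k(x)\quad\text{for all }(x,t)\in\mathbb{R}^d\times[0,T]\text{ and all }k;$$ (ii) the function $(x,t)\mapsto(1+|x|)^{-1}|b_k(x,t)|$ is bounded on $\mathbb{R}^d\times[0,T]$ for every $k$, and $b_k\to b$ uniformly on $U\times[0,T]$ for every ball $U\subset\mathbb{R}^d$. Then, for every nonnegative finite Borel measure $\nu$ on $\mathbb{R}^d$ such that $\sup_k\|V_k\|_{L^1(\nu)}<\infty$, there exists a family of nonnegative finite Borel measures $(\mu_t)_{t\in[0,T]}$ on $\mathbb{R}^d$ solving the Cauchy problem $$\partial_t\mu+\mathrm{div}(b\mu)=0,\qquad\mu|_{t=0}=\nu$$ with the following property: for every ball $U\subset\mathbb{R}^d$ one has $$\lim_{k\to\infty}\int_0^T\int_U|b-b_k|\sqrt{V_k}\,d\mu_t\,dt=0.$$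
   Context: $T>0$ is fixed. A locally bounded Borel measure on $\mathbb{R}^d$ is a real-valued (possibly signed) function on the class of all bounded Borel sets that is countably additive on the Borel subsets of every compact set; locally bounded Borel measures on $\mathbb{R}^d\times[0,T]$ are defined similarly. $|\mu|$ denotes the total variation of $\mu$. A family $(\mu_t)_{t\in[0,T]}$ of locally bounded Borel measures on $\mathbb{R}^d$ solves the Cauchy problem $\partial_t\mu+\mathrm{div}(b\mu)=0$, $\mu|_{t=0}=\nu$, if the following holds. First, for every bounded Borel set $B\subset\mathbb{R}^d$ the mapping $t\mapsto\mu_t(B)$ is measurable, $t\mapsto|\mu_t|(K)$ belongs to $L^1[0,T]$ for every compact $K\subset\mathbb{R}^d$, and $\mu$ denotes the locally bounded Borel measure on $\mathbb{R}^d\times[0,T]$ given by the family $(\mu_t)_{t\in[0,T]}$, that is, $\mu=\mu_t(dx)\,dt$, so that $$\int_0^T\int_{\mathbb{R}^d}u(x,t)\,\mu(dx\,dt)=\int_0^T\int_{\mathbb{R}^d}u(x,t)\,\mu_t(dx)\,dt\quad\text{for all }u\in C_0^\infty(\mathbb{R}^d\times(0,T)).$$ Second, $b\in L^1(|\mu|,U\times[0,T])$ for every ball $U\subset\mathbb{R}^d$ and, for every function $u$ that is continuous on $\mathbb{R}^d\times[0,T)$ along with its first order derivatives in $t$ and $x$ and satisfies $u(x,t)=0$ whenever $|x|>R$ for some $R$, one has $$\int_{\mathbb{R}^d}u(x,t)\,\mu_t(dx)=\int_{\mathbb{R}^d}u(x,0)\,\nu(dx)+\int_0^t\int_{\mathbb{R}^d}\bigl[\partial_tu+\langle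 b,\nabla u\rangle\bigr]\,\mu_s(dx)\,ds$$ for almost every $t\in[0,T]$. *)

(* Defs.v *)
From HB Require Import structures.
From mathcomp Require Export all_boot all_order all_algebra.
From mathcomp Require Export all_classical all_reals all_analysis.
From mathcomp Require Export measurable_realfun.

Set Implicit Arguments.
Unset Strict Implicit.
Unset Printing Implicit Defensive.
Import Order.TTheory GRing.Theory Num.Theory numFieldNormedType.Exports.

Local Open Scope classical_set_scope.
Local Open Scope ring_scope.

Section Euclidean.
Context {R : realType} {d : nat}.

Definition dotr (x y : 'rV[R]_d) : R := \sum_(i < d) x 0 i * y 0 i.

(* Needed because the library norm [`|x|] of ['rV[R]_d] is the sup norm. *)
Definition enorm (x : 'rV[R]_d) : R := Num.sqrt (dotr x x).
Definition eball (a : 'rV[R]_d) (r : R) : set 'rV[R]_d :=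
  [set x | enorm (x - a) < r].

Definition grad (f : 'rV[R]_d -> R) (x : 'rV[R]_d) : 'rV[R]_d :=
  \row_(i < d) 'D_('e_i) f x.

End Euclidean.

(* [Cn E n f]: all iterated derivatives of [f] of order at most [n], in
   directions taken from [E], exist everywhere and are continuous.  With [E]
   the set of coordinate directions this is the usual class C^n. *)
Fixpoint Cn {R : realType} {V W : normedModType R} (E : set V) (n : nat)
    (f : V -> W) : Prop :=
  continuous f /\
  (if n is m.+1 then
     forall e, E e -> (forall x, derivable f x e) /\ Cn E m ('D_e f)
   else True).

Section Smooth.
Context {R : realType} (d : nat).

Definition space_axes : set 'rV[R]_d := range (fun i : 'I_d => 'e_i).

Definition spacetime_axes : set ('rV[R]_d * R) :=
  [set (e, 0) | e in space_axes] `|` [set (0, 1)].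

Definition C1_space (f : 'rV[R]_d -> R) : Prop := Cn space_axes 1 f.

Definition smooth_spacetime {W : normedModType R} (f : 'rV[R]_d * R -> W) :
  Prop := forall n, Cn spacetime_axes n f.

Definition smooth_compact_support (T : R) (u : 'rV[R]_d * R -> R) : Prop :=
  smooth_spacetime u /\
  exists K : set ('rV[R]_d * R),
    [/\ compact K, K `<=` setT `*` `]0, T[ & forall z, ~ K z -> u z = 0].

(* [u] is of class C^1 on R^d x [0,T[, with time derivative [ut] (one-sided
   at t = 0) and spatial gradient [ux]. *)
Record C1_slab (T : R) (u ut : 'rV[R]_d * R -> R)
    (ux : 'rV[R]_d * R -> 'rV[R]_d) : Prop := {
  slab_cont : {within setT `*` `[0, T[, continuous u};
  slab_cont_t : {within setT `*` `[0, T[, continuous ut};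
  slab_cont_x : {within setT `*` `[0, T[, continuous ux};
  slab_deriv_t : forall (x : 'rV[R]_d) (t : R), 0 <= t < T ->
    h^-1 * (u (x, t + h) - u (x, t))
      @[h --> within [set h | 0 <= t + h < T] 0^'] --> ut (x, t);
  slab_deriv_x : forall (x : 'rV[R]_d) (t : R), 0 <= t < T -> forall i : 'I_d,
    is_derive x 'e_i (fun y => u (y, t)) (ux (x, t) 0 i) }.

End Smooth.

Notation borelRV R d := (g_sigma_algebraType (@open 'rV[R]_d)).

Section CauchyProblem.
Context {R : realType} {d : nat}.
Implicit Types (T : R) (b : 'rV[R]_d * R -> 'rV[R]_d)
  (mu : R -> {finite_measure set (borelRV R d) -> \bar R})
  (nu : {finite_measure set (borelRV R d) -> \bar R})
  (m : {measure set (borelRV R d * measurableTypeR R) -> \bar R}).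

Local Open Scope ereal_scope.

(* All families here consist of nonnegative finite measures: local boundedness
   is automatic and the total variation |mu_t| is mu_t itself. *)
Definition admissible_family T mu : Prop :=
  (forall B : set (borelRV R d), measurable B ->
     bounded_set (B : set 'rV[R]_d) ->
     measurable_fun `[0%R, T] (fun t : measurableTypeR R => mu t B)) /\
  (forall K : set 'rV[R]_d, compact K ->
     lebesgue_measure.-integrable `[0%R, T]
       (fun t : measurableTypeR R => mu t K)).

(* [m] is the measure mu_t(dx) dt on R^d x [0,T], extended by zero to
   R^d x R; the second clause is its characterization by test functions. *)
Definition given_by_family T mu m : Prop :=
  (forall A : set (borelRV R d * measurableTypeR R), measurable A ->
     m A = \int[lebesgue_measure]_(t in `[0%R, T]) mu t (ysection A t)) /\
  (forall u : 'rV[R]_d * R -> R, smooth_compact_support T u ->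
     \int[m]_(z in setT `*` `[0%R, T]) (u z)%:E =
     \int[lebesgue_measure]_(t in `[0%R, T]) \int[mu t]_x (u (x, t))%:E).

(* The exceptional null set of times may depend on the test function [u]; the
   derivatives of [u] are passed as [ut] and [ux]. *)
Definition solves_cauchy T b nu mu : Prop :=
  [/\ admissible_family T mu,
      exists m, given_by_family T mu m /\
        (forall (a : 'rV[R]_d) (r : R) (i : 'I_d),
          m.-integrable (eball a r `*` `[0%R, T]) (fun z => (b z 0%R i)%:E)) &
      forall u ut ux, C1_slab T u ut ux ->
        (exists r : R, forall (x : 'rV[R]_d) (t : R),
           (0 <= t < T)%R -> (r < enorm x)%R -> u (x, t) = 0%R) ->
        {ae lebesgue_measure, forall t : measurableTypeR R,
          (0 <= t <= T)%R ->
          \int[mu t]_x (u (x, t))%:E =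
          \int[nu]_x (u (x, 0%R))%:E +
          \int[lebesgue_measure]_(s in `[0%R, t])
            \int[mu s]_x
              (ut (x, s) + dotr (b (x, s)) (ux (x, s)))%:E}].

End CauchyProblem.

(* Main.v *)
(* For each m take Euler polygons of the field b_m, with a step so small that on
   the ball of radius m they almost satisfy V_m(X_t) <= e^(Ct) V_m(x).  Along a
   subsequence chosen measurably in the starting point x, the polygons converge,
   for every t, in the one-point compactification of R^d: Lipschitz functions
   with compact support are asymptotically equi-Lipschitz along them, because
   the b_m are locally uniformly bounded.  A test function with compact support
   in x vanishes at infinity, so the limit path Y satisfies
     u(Y_t, t) = u(x, 0) + int_0^t (d_s u + <b, grad u>)(Y_s, s) ds,
   where u(Y_t, t) and the integrand are read as 0 when Y is at infinity; no
   analysis of explosion times is needed.  Then mu_t is the image of nu under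
   Y_t, restricted to R^d.  By (i), V_k(Y_t) <= al V_l(x) + be for all large l,
   so by Fatou V_k is integrable for mu_t uniformly in k and t, which gives the
   last claim since sqrt V <= 1 + V. *)
Require Import Defs.
From HB Require Import structures.
From mathcomp Require Import ring lra.
Import Order.TTheory GRing.Theory Num.Theory numFieldNormedType.Exports.

Set Implicit Arguments.
Unset Strict Implicit.
Unset Printing Implicit Defensive.

Local Open Scope classical_set_scope.
Local Open Scope ring_scope.

(** * Measurable choice of a subsequence *)

(** Since [b] is only continuous, limit paths need not be unique, and no single subsequence need
    serve all [x]. To keep the choice measurable it is reduced to countably many Borel conditions on
    [x]: a Lipschitz test function of the polygon at a rational time lies below a rational number.
    Along the chosen indices each condition is eventually constant, which forces convergence at
    rational times; equicontinuity extends it to all times. The growth constants in (ii) may depend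
    on the index. They only confine the m-th polygons to some ball before the step is fixed. What is
    used in the limit is (i), local uniform convergence, and the fact that steps of length at most 1
    cannot enter the support of a test function from far away. The Lyapunov estimate holds at an
    index m depending on [x], so V_m(x) cannot be integrated directly. Applying (i) a second time,
    at the starting point, replaces it by V_l(x) for every l >= m; the lower limit over l is then
    one integrable majorant for all k and t. *)

Section MeasurableSelection.
Context d (X : measurableType d) (P : nat -> nat -> set X).
Hypothesis mP : forall a m, measurable (P a m).

(** The limit superior of the sets [Q m]: the points that lie in infinitely many of them. *)
Let frequently (Q : nat -> set X) : set X :=
  \bigcap_k \bigcup_(m in [set m | (k <= m)%N]) Q m.

(* [index_set a] is an infinite set of indices, depending measurably on [x], on
   which the truth values of [P 0], ..., [P (a - 1)] at [x] are constant. *)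
Fixpoint index_set (a : nat) : nat -> set X :=
  if a is a'.+1 then
    let F := frequently (fun m => index_set a' m `&` P a' m) in
    fun m => index_set a' m `&` ((F `&` P a' m) `|` (~` F `&` ~` P a' m))
  else fun=> setT.

Let measurable_frequently (Q : nat -> set X) :
  (forall m, measurable (Q m)) -> measurable (frequently Q).
Proof.
move=> mQ; apply: bigcapT_measurable => k.
exact: bigcup_measurable.
Qed.

Lemma measurable_index_set a m : measurable (index_set a m).
Proof.
elim: a m => [|a IH] m //=; have mF := measurable_frequently
  (fun m => measurableI _ _ (IH m) (mP a m)).
apply: measurableI => //; apply: measurableU; apply: measurableI => //;
  exact: measurableC.
Qed.

(** Splitting an infinite set of indices in two leaves one infinite half. If the half where [P a]
    holds is finite, the indices past its last element all lie in the other half. *)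
Lemma index_set_infinite a x k : exists2 m, (k <= m)%N & index_set a m x.
Proof.
elim: a k => [|a IH] k /=; first by exists k.
set F := frequently _; have [Fx|nFx] := pselect (F x).
  have [m /= km [Ix Px]] := Fx k I.
  by exists m => //; split => //; left.
have [l nl] : exists l, forall m, (l <= m)%N ->
    ~ (index_set a m `&` P a m) x.
  apply: contrapT => H; apply: nFx => l _.
  apply: contrapT => H'; apply: H; exists l => m lm Im; apply: H'.
  by exists m.
have [m klm Ix] := IH (maxn k l).
exists m; first exact: leq_trans (leq_maxl _ _) klm.
split => //; right; split => // Px.
by apply: (nl m); [exact: leq_trans (leq_maxr _ _) klm|].
Qed.

Lemma index_setS a l m x : (a <= l)%N -> index_set l m x -> index_set a m x.
Proof.
move=> /subnK <-; elim: (l - a)%N => [//|n IH].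
by rewrite addSn /= => -[/IH].
Qed.

(** Diagonal choice: [s j x] is the least index [m >= j] in [index_set j]. Minimality makes each
    event [s j x = n] a Boolean combination of finitely many index sets, hence measurable. The index
    sets decrease, so for [l > a] the index [s l x] lies in [index_set a.+1], on which the truth
    value of [P a] is already frozen. *)
Lemma selection_exists : exists s : nat -> X -> nat,
  [/\ forall j n, measurable [set x | s j x = n],
      forall j x, (j <= s j x)%N &
      forall a x, (forall l, (a < l)%N -> P a (s l x) x) \/
                  (forall l, (a < l)%N -> ~ P a (s l x) x)].
Proof.
have ex j x : exists m, (j <= m)%N && `[< index_set j m x >].
  have [m jm Im] := index_set_infinite j x j.
  by exists m; rewrite jm; apply/asboolP.
exists (fun j x => ex_minn (ex j x)); split.
- move=> j n.
  have -> : [set x | ex_minn (ex j x) = n] =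
      (if (j <= n)%N then index_set j n else set0) `&`
      \bigcap_(m in [set m | (j <= m < n)%N]) ~` index_set j m.
    apply/seteqP; split => x /=.
      case: ex_minnP => m /andP[jm /asboolP Im] minm <-; rewrite jm; split => //.
      move=> k /= /andP[jk km] Ik.
      by have := minm k; rewrite jk/= leqNgt km => /(_ (introT (asboolP _) Ik)).
    case: ifP => [jn [In H]|_ []//]; case: ex_minnP => m /andP[jm /asboolP Im] minm.
    apply/eqP; rewrite eqn_leq; apply/andP; split.
      by apply: minm; rewrite jn; apply/asboolP.
    by rewrite leqNgt; apply/negP => mn; apply: (H m) => //=; rewrite jm.
  apply: measurableI; first by case: ifP => // _; exact: measurable_index_set.
  by apply: bigcap_measurableType => m _; exact/measurableC/measurable_index_set.
- by move=> j x; case: ex_minnP => m /andP[].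
- move=> a x.
  have H l : (a < l)%N -> index_set a.+1 (ex_minn (ex l x)) x.
    move=> al; case: ex_minnP => m /andP[_ /asboolP Im] _.
    exact: index_setS al Im.
  set F := frequently (fun m => index_set a m `&` P a m).
  have [Fx|nFx] := pselect (F x); [left|right] => l /H /= [_ [[]|[]]] //.
Qed.
End MeasurableSelection.

(** * Norms, uniform continuity and first order expansions *)

Section EpsilonDelta.
Context {R : realType} {V W : normedModType R}.
Implicit Types (A K : set V) (g : V -> W).

Lemma within_continuousE A g : {within A, continuous g} <->
  forall x, A x -> forall e, 0 < e -> exists2 r, 0 < r &
    forall y, A y -> `|x - y| < r -> `|g x - g y| < e.
Proof.
rewrite subspace_continuousP; split=> H x Ax.
  move=> e e0; have /cvgrPdist_lt/(_ _ e0) := H x Ax.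
  rewrite near_withinE => /nbhs_ballP[r /= r0 rP]; exists r => // y Ay xy.
  by apply: rP => //; rewrite -ball_normE.
apply/cvgrPdist_lt => e e0; have [r r0 rP] := H x Ax e e0.
rewrite near_withinE; apply/nbhs_ballP; exists r => //= y.
by rewrite -ball_normE /= => xy Ay; exact: rP.
Qed.

(** The Heine-Cantor theorem, for continuity relative to [K] only. *)
Lemma compact_uniform K g : compact K -> {within K, continuous g} ->
  forall e, 0 < e -> exists2 r, 0 < r &
    forall x y, K x -> K y -> `|x - y| < r -> `|g x - g y| < e.
Proof.
move=> cK /within_continuousE cg e e0.
have /near_covering_withinP H := (compact_near_coveringP K).1 cK.
pose P (r : R) (x : V) := forall y, K y -> `|x - y| < r -> `|g x - g y| < e.
have : \forall r \near 0^'+, K `<=` P r.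
  apply: H => x Kx; have [r r0 rP] := cg x Kx (e / 2) (divr_gt0 e0 (ltr0n _ 2)).
  exists (ball x (r / 2), [set s | s < r / 2]) => /=.
    split; first by apply: nbhsx_ballx; rewrite divr_gt0.
    by apply: nbhs_right_lt; rewrite divr_gt0.
  move=> [x' s] [/=]; rewrite -ball_normE /= => xx' sr Kx' y Ky x'y.
  have := rP y Ky; have := rP x' Kx'.
  have -> : g x' - g y = (g x - g y) - (g x - g x') by rewrite opprB [RHS]addrC addrA subrK.
  move=> /(_ ltac:(lra)) h1.
  have : `|x - y| < r.
    rewrite -(subrK x' x) -addrA; apply: le_lt_trans (ler_normD _ _) _; lra.
  move=> /[swap]/[apply] h2; apply: le_lt_trans (ler_normB _ _) _; lra.
case=> r /= r0 rP; exists (r / 2); first by rewrite divr_gt0.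
  move=> x y Kx Ky xy; apply: (rP (r / 2)) Kx y Ky xy => /=.
    by rewrite sub0r normrN gtr0_norm ?divr_gt0//; lra.
  by rewrite divr_gt0.
Qed.

Lemma compact_bound K g : compact K -> {within K, continuous g} ->
  exists2 M, 0 < M & forall x, K x -> `|g x| <= M.
Proof.
move=> cK cg; have /compact_bounded[M [_ HM]] := continuous_compact cg cK.
exists (`|M| + 1); first by rewrite ltr_wpDl.
move=> x Kx; apply: HM; last by exists x.
by rewrite (le_lt_trans (ler_norm M))// ltrDl.
Qed.

End EpsilonDelta.

Lemma sum_ord_le {R : realType} n (F : 'I_n -> R) c :
  (forall i, F i <= c) -> \sum_(i < n) F i <= n%:R * c.
Proof.
move=> Fc; rewrite mulr_natl -[X in c *+ X]card_ord -sumr_const.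
exact: ler_sum.
Qed.

Section SupNorm.
Context {R : realType} {d : nat}.
Implicit Types (x y : 'rV[R]_d).

Lemma coord_le_norm x i : `|x 0 i| <= `|x|.
Proof.
rewrite [leRHS]/Num.norm /= mx_normrE; apply/bigmax_geP; right => /=.
by exists (0, i).
Qed.

Lemma norm_le_coord x r : 0 <= r -> (forall i, `|x 0 i| <= r) -> `|x| <= r.
Proof.
move=> r0 H; rewrite [leLHS]/Num.norm /= mx_normrE; apply/bigmax_leP; split => //=.
by move=> [i j] _ /=; rewrite (ord1 i).
Qed.

Lemma dotrC x y : dotr x y = dotr y x.
Proof. by apply: eq_bigr => i _; rewrite mulrC. Qed.

Lemma dotrZr x y c : dotr x (c *: y) = c * dotr x y.
Proof. by rewrite /dotr mulr_sumr; apply: eq_bigr => i _; rewrite mxE mulrCA. Qed.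

Lemma dotr_ge0 x : 0 <= dotr x x.
Proof. by apply: sumr_ge0 => i _; rewrite -expr2 sqr_ge0. Qed.

Lemma norm_le_enorm x : `|x| <= enorm x.
Proof.
apply: norm_le_coord; first exact: sqrtr_ge0.
move=> i; rewrite -sqrtr_sqr ler_sqrt ?dotr_ge0// /dotr (bigD1 i)//= expr2 lerDl.
by apply: sumr_ge0 => j _; rewrite -expr2 sqr_ge0.
Qed.

Lemma norm_dotr_le x y : `|dotr x y| <= d%:R * `|x| * `|y|.
Proof.
apply: le_trans (ler_norm_sum _ _ _) _.
rewrite -mulrA; apply: sum_ord_le => i.
by rewrite normrM ler_pM// coord_le_norm.
Qed.

Lemma enorm_le x : enorm x <= d%:R * `|x|.
Proof.
rewrite -[leRHS]ger0_norm ?mulr_ge0// -sqrtr_sqr ler_sqrt ?sqr_ge0//.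
apply: le_trans (ler_norm _) _; apply: le_trans (norm_dotr_le _ _) _.
rewrite expr2 mulrACA -[leLHS]mulrA ler_wpM2r ?mulr_ge0//.
by rewrite -natrM ler_nat; case: (d) => // n; rewrite leq_pmulr.
Qed.

Lemma compact_norm_le r : compact [set x : 'rV[R]_d | `|x| <= r].
Proof.
apply: bounded_closed_compact.
  by exists r; split => [|M rM x /= xr]; [exact: num_real|rewrite (le_trans xr)// ltW].
have := @closed_closed_ball_ R 'rV[R]_d 0 r; rewrite /closed_ball_.
by under eq_fun => x do rewrite sub0r normrN.
Qed.

Lemma compact_slab r (s t : R) :
  compact ([set x : 'rV[R]_d | `|x| <= r] `*` `[s, t]).
Proof. by apply: compact_setX; [exact: compact_norm_le|exact: segment_compact]. Qed.

End SupNorm.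

Section Increments.
Context {R : realType}.

Lemma line_increment (g g' : R -> R) (r c e : R) :
  (forall s : R, is_derive s 1 g (g' s)) ->
  (forall s : R, `|s| <= `|r| -> `|g' s - c| <= e) ->
  `|g r - g 0 - c * r| <= e * `|r|.
Proof.
move=> dg He.
have cg a b : {within `[a, b], continuous g}.
  apply: continuous_subspaceT => s; apply: differentiable_continuous.
  by apply/derivable1_diffP; have [] := dg s.
suff [s sr ->] : exists2 s, `|s| <= `|r| & g r - g 0 = g' s * r.
  by rewrite -mulrBl normrM ler_wpM2r// He.
have [r0|r0] := leP 0 r.
  have [s] := MVT_segment r0 (fun s _ => dg s) (cg _ _).
  rewrite in_itv /= => /andP[s0 sr]; rewrite subr0 => ->; exists s => //.
  by rewrite !ger0_norm.
have [s] := MVT_segment (ltW r0) (fun s _ => dg s) (cg _ _).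
rewrite in_itv /= => /andP[s0 sr] E; exists s; first by rewrite !ler0_norm ?lerN2 // ltW.
by rewrite -opprB E sub0r mulrN opprK.
Qed.

Context {d : nat}.

Lemma is_derive_line (f : 'rV[R]_d -> R) (w v : 'rV[R]_d) (s c : R) :
  is_derive (w + s *: v) v f c -> is_derive s 1 (fun r => f (w + r *: v)) c.
Proof.
move=> [df Dc].
have E : (fun h : R => h^-1 *: (((fun r => f (w + r *: v)) \o shift s) (h *: 1) -
    f (w + s *: v))) =
  (fun h : R => h^-1 *: ((f \o shift (w + s *: v)) (h *: v) - f (w + s *: v))).
  apply/funext => h /=; do 3 f_equal.
  by rewrite [h *: 1]mulr1 scalerDl addrCA addrA.
by split; rewrite /derivable /derive E.
Qed.

(** Only partial derivatives are given, so [x] is moved to [y] one coordinate at a time, with the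
    mean value theorem on each edge. In the sup norm no edge leaves the ball of radius [|y - x|]
    about [x]. *)
Lemma space_increment (f : 'rV[R]_d -> R) (Df : 'rV[R]_d -> 'rV[R]_d)
    (x y c : 'rV[R]_d) (e : R) :
  (forall z i, is_derive z 'e_i f (Df z 0 i)) ->
  (forall z, `|z - x| <= `|y - x| -> `|Df z - c| <= e) ->
  `|f y - f x - dotr c (y - x)| <= d%:R * e * `|y - x|.
Proof.
move=> dDf He.
pose w k : 'rV[R]_d := \row_i (if (i < k)%N then y 0 i else x 0 i).
have w0 : w 0%N = x by apply/rowP => i; rewrite mxE.
have wd : w d = y by apply/rowP => i; rewrite mxE ltn_ord.
have wS (k : 'I_d) r : `|r| <= `|y 0 k - x 0 k| -> `|w k + r *: 'e_k - x| <= `|y - x|.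
  move=> hr; apply: norm_le_coord => // i; rewrite !mxE eqxx /=.
  have := coord_le_norm (y - x) i; rewrite !mxE => yx.
  case: (eqVneq i k) => [->|ik]; last first.
    by rewrite mulr0 addr0; case: ifP => // _; rewrite subrr normr0.
  rewrite ltnn mulr1 addrAC subrr add0r; apply: le_trans hr _.
  by have := coord_le_norm (y - x) k; rewrite !mxE.
have step (k : 'I_d) : `|f (w k.+1) - f (w k) - c 0 k * (y 0 k - x 0 k)| <= e * `|y - x|.
  pose r := y 0 k - x 0 k.
  have -> : w k.+1 = w k + r *: 'e_k.
    apply/rowP => i; rewrite !mxE eqxx /= ltnS leq_eqVlt.
    case: (eqVneq i k) => [->|ik] /=; first by rewrite eqxx ltnn/= mulr1 addrC subrK.
    by rewrite (negbTE (_ : (i : nat) != k))//= mulr0 addr0.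
  have := @line_increment (fun r => f (w k + r *: 'e_k))
    (fun r => Df (w k + r *: 'e_k) 0 k) r (c 0 k) e.
  rewrite scale0r addr0 => H; apply: le_trans (H _ _) _.
  - by move=> s; apply: is_derive_line.
  - move=> s sr; have := He _ (wS k s sr); apply: le_trans.
    by have := coord_le_norm (Df (w k + s *: 'e_k) - c) k; rewrite !mxE.
  - have := coord_le_norm (y - x) k; rewrite !mxE -/r => ry.
    rewrite ler_wpM2l//; apply: le_trans (He x _); first by [].
    by rewrite subrr normr0.
have -> : f y - f x - dotr c (y - x) =
    \sum_(k < d) (f (w k.+1) - f (w k) - c 0 k * (y 0 k - x 0 k)).
  rewrite big_split /= sumrN; congr (_ - _); last first.
    by apply: eq_bigr => i _; rewrite !mxE.
  have := telescope_sumr (fun k => f (w k)) (leq0n d).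
  by rewrite w0 wd big_mkord => <-.
apply: le_trans (ler_norm_sum _ _ _) _.
by rewrite -mulrA; exact: sum_ord_le.
Qed.

End Increments.

Section Taylor.
Context {R : realType} {d : nat}.
Implicit Types (T : R) (x y : 'rV[R]_d).

Lemma pair_norm_lt (x y : 'rV[R]_d) (s t r : R) :
  `|x - y| < r -> `|s - t| < r -> `|(x, s) - (y, t)| < r.
Proof. by move=> h1 h2; rewrite prod_normE gt_max h1 h2. Qed.

Lemma within_slab_section (W : normedModType R) (A B : set R)
    (g : 'rV[R]_d * R -> W) x :
  B `<=` A -> {within setT `*` A, continuous g} ->
  {within B, continuous (fun t => g (x, t))}.
Proof.
move=> BA /within_continuousE cg; apply/within_continuousE => t Bt e e0.
have [r r0 rP] := cg (x, t) (conj I (BA _ Bt)) e e0.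
exists r => // s Bs ts; apply: rP; first by split=> //; exact: BA.
by apply: pair_norm_lt => //; rewrite subrr normr0.
Qed.

(** At an interior time the restricted difference quotient of [C1_slab] is an ordinary one for small
    [h]; at [s = 0] the mean value theorem asks only for continuity. *)
Lemma time_increment T (u ut : 'rV[R]_d * R -> R) ux x (s s' c e : R) :
  C1_slab T u ut ux -> 0 <= s -> s <= s' -> s' < T ->
  (forall r, s <= r <= s' -> `|ut (x, r) - c| <= e) ->
  `|u (x, s') - u (x, s) - c * (s' - s)| <= e * (s' - s).
Proof.
move=> su s0 ss' s'T He.
have du r : r \in `]s, s'[ -> is_derive r 1 (fun r => u (x, r)) (ut (x, r)).
  rewrite in_itv /= => /andP[sr rs'].
  suff H : h^-1 *: (((fun r => u (x, r)) \o shift r) (h *: 1) - u (x, r))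
      @[h --> 0^'] --> ut (x, r).
    by split; [apply/cvg_ex; exists (ut (x, r))|apply/cvg_lim].
  have r0T : 0 <= r < T by apply/andP; split; lra.
  apply/cvgrPdist_lt => eps eps0.
  have /cvgrPdist_lt/(_ eps eps0) := @slab_deriv_t _ _ _ _ _ _ su x r r0T.
  rewrite near_withinE => H.
  have H0 : \forall h \near 0^', 0 <= r + h < T.
    rewrite near_withinE; exists (Num.min r (T - r)) => /=.
      by rewrite lt_min; apply/andP; split; lra.
    move=> h /=; rewrite sub0r normrN lt_min ltr_norml => /andP[/andP[? ?] /ltr_normlP[? ?]] _.
    by apply/andP; split; lra.
  near=> h; have := near H h; rewrite /= [h *: 1]mulr1 (addrC h); apply => //.
  by near: h.
have cu : {within `[s, s'], continuous (fun r => u (x, r))}.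
  apply: (@within_slab_section R `[0, T[ `[s, s'] u x _ (slab_cont su)) => r /=.
  by rewrite !in_itv /= => /andP[? ?]; apply/andP; split; lra.
have [r] := MVT_segment ss' du cu; rewrite in_itv /= => /He h ->.
by rewrite -mulrBl normrM (@ger0_norm _ (s' - s)) ?ler_wpM2r// subr_ge0.
Unshelve. all: by end_near. Qed.

(** The increment is split into a move in time at fixed [x] and a move in space at time [s'];
    uniform continuity of [ut] and [ux] on a compact slab allows freezing both at [(x, s)]. *)
Lemma slab_taylor T (u ut : 'rV[R]_d * R -> R) ux (t N e : R) :
  C1_slab T u ut ux -> t < T -> 0 < e ->
  exists2 r, 0 < r & forall x y s s', `|x| <= N -> `|y - x| < r ->
    0 <= s -> s <= s' -> s' <= t -> s' - s < r ->
    `|u (y, s') - u (x, s) - (ut (x, s) * (s' - s) + dotr (ux (x, s)) (y - x))| <=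
    e * (s' - s + `|y - x|).
Proof.
move=> su tT e0.
pose K := [set x : 'rV[R]_d | `|x| <= N + 1] `*` `[0, t].
have cK : compact K by exact: compact_slab.
have KS : K `<=` setT `*` `[0, T[.
  by move=> [x s] [_ /=]; rewrite !in_itv /= => /andP[-> /le_lt_trans ->].
(* [space_increment] loses a factor [d]; dividing by [d + 1] compensates and stays meaningful for
   [d = 0]. *)
pose e' := e / d.+1%:R; have e'0 : 0 < e' by rewrite divr_gt0.
have de' : d%:R * e' <= e.
  by rewrite /e' mulrA ler_pdivrMr// mulrC ler_pM2l// ler_nat.
have e'e : e' <= e by rewrite ler_pdivrMr// ler_peMr ?ler1n// ltW.
have [r1 r10 H1] := compact_uniform cK (continuous_subspaceW KS (slab_cont_t su)) e'0.
have [r2 r20 H2] := compact_uniform cK (continuous_subspaceW KS (slab_cont_x su)) e'0.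
exists (Num.min 1 (Num.min r1 r2)); first by rewrite !lt_min ltr01 r10.
move=> x y s s' xN + s0 ss' s't; rewrite !lt_min => /and3P[yx1 yx2 yx3] /and3P[_ st1 st2].
have Kx r : s <= r <= s' -> K (x, r).
  by move=> /andP[? ?]; split => /=; [lra|rewrite in_itv /=; apply/andP; split; lra].
have Kz z : `|z - x| <= `|y - x| -> K (z, s').
  move=> zx; split => /=; last by rewrite in_itv /=; apply/andP; split; lra.
  by rewrite -(subrK x z); apply: le_trans (ler_normD _ _) _; lra.
have h1 : `|u (x, s') - u (x, s) - ut (x, s) * (s' - s)| <= e' * (s' - s).
  apply: time_increment su _ _ _ _ => //; first lra.
  move=> r sr; have /andP[? ?] := sr; rewrite distrC ltW//; apply: H1.
  - by apply: Kx; rewrite lexx.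
  - exact: Kx.
  - by apply: pair_norm_lt; rewrite ?subrr ?normr0// distrC ger0_norm; lra.
have h2 : `|u (y, s') - u (x, s') - dotr (ux (x, s)) (y - x)| <= d%:R * e' * `|y - x|.
  apply: (space_increment (f := fun z => u (z, s')) (Df := fun z => ux (z, s'))) => [z i|z zx].
    by apply: (slab_deriv_x su); apply/andP; split; lra.
  rewrite distrC ltW//; apply: H2.
  - by apply: Kx; rewrite lexx.
  - exact: Kz.
  - apply: pair_norm_lt; last by rewrite distrC ger0_norm; lra.
    by rewrite distrC (le_lt_trans zx).
have -> : u (y, s') - u (x, s) - (ut (x, s) * (s' - s) + dotr (ux (x, s)) (y - x)) =
   (u (x, s') - u (x, s) - ut (x, s) * (s' - s)) +
   (u (y, s') - u (x, s') - dotr (ux (x, s)) (y - x)) by ring.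
apply: le_trans (ler_normD _ _) _; rewrite [leRHS]mulrDr lerD//.
  by apply: le_trans h1 _; rewrite ler_wpM2r// subr_ge0.
by apply: le_trans h2 _; rewrite ler_wpM2r.
Qed.

Lemma slab_zero_derivatives T (u ut : 'rV[R]_d * R -> R) ux r :
  C1_slab T u ut ux ->
  (forall x t, 0 <= t < T -> r < `|x| -> u (x, t) = 0) ->
  forall x t, 0 <= t < T -> r < `|x| -> ut (x, t) = 0 /\ ux (x, t) = 0.
Proof.
move=> su u0 x s /andP[s0 sT] rx.
pose t := (s + T) / 2.
have st : s < t by rewrite /t; lra.
have tT : t < T by rewrite /t; lra.
have small e : 0 < e -> `|ut (x, s)| <= e /\ forall i, `|ux (x, s) 0 i| <= e.
  move=> e0; have [rho rho0 H] := slab_taylor (`|x|) su tT e0.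
  (* A displacement [k] in time or along an axis stays within the Taylor radius, before time [t],
     and in the region where [u] vanishes. *)
  pose k := Num.min (rho / 2) (Num.min (t - s) ((`|x| - r) / 2)).
  have k0 : 0 < k by rewrite !lt_min; apply/and3P; split; lra.
  have [k1 [k2 k3]] : k <= rho / 2 /\ k <= t - s /\ k <= (`|x| - r) / 2.
    by rewrite !ge_min !lexx !orbT.
  split.
    have sk : s + k - s = k by ring.
    have := H x x s (s + k) (lexx _).
    rewrite subrr normr0 !u0//; try (apply/andP; split; lra).
    move=> /(_ rho0 s0 ltac:(lra) ltac:(lra) ltac:(rewrite sk; lra)).
    rewrite sk subrr sub0r normrN addr0.
    have -> : dotr (ux (x, s)) 0 = 0 by rewrite /dotr big1// => i _; rewrite mxE mulr0.
    by rewrite addr0 normrM (gtr0_norm k0) ler_pM2r.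
  move=> i; have ek : `|k *: ('e_i : 'rV[R]_d)| <= k.
    apply: norm_le_coord => [|j]; first exact: ltW.
    rewrite !mxE eqxx /=; case: (j == i); rewrite ?mulr1 ?mulr0 ?normr0 ?(ltW k0)//.
    by rewrite gtr0_norm.
  have xk : x + k *: 'e_i - x = k *: 'e_i by rewrite addrAC subrr add0r.
  have := H x (x + k *: 'e_i) s s (lexx _).
  rewrite xk subrr mulr0 add0r !u0//; try (apply/andP; split; lra); last first.
    have : `|x| <= `|x + k *: ('e_i : 'rV[R]_d)| + `|k *: ('e_i : 'rV[R]_d)|.
      by rewrite -{1}(addrK (k *: 'e_i) x) ler_normB.
    lra.
  move=> /(_ ltac:(lra) s0 (lexx _) (ltW st) rho0).
  rewrite subrr sub0r normrN add0r dotrZr normrM (gtr0_norm k0).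
  have -> : dotr (ux (x, s)) 'e_i = ux (x, s) 0 i.
    rewrite /dotr (bigD1 i)//= mxE !eqxx mulr1 big1 ?addr0// => j ji.
    by rewrite mxE (negbTE ji) andbF mulr0.
  move=> h; rewrite -(ler_pM2l k0); apply: le_trans h _.
  by rewrite mulrC ler_pM2r.
split.
  apply/eqP; rewrite -normr_eq0 eq_le normr_ge0 andbT leNgt; apply/negP => a0.
  have [] := small (`|ut (x, s)| / 2) ltac:(lra); lra.
apply/rowP => i; rewrite mxE; apply/eqP; rewrite -normr_eq0 eq_le normr_ge0 andbT leNgt.
apply/negP => a0; have [_ /(_ i)] := small (`|ux (x, s) 0 i| / 2) ltac:(lra); lra.
Qed.

Lemma C1_space_continuous (f : 'rV[R]_d -> R) : C1_space f -> continuous f.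
Proof. by case. Qed.

Lemma C1_space_grad (f : 'rV[R]_d -> R) : C1_space f -> continuous (grad f).
Proof.
move=> [_ H] x; apply/(@cvgrPdist_lt R _ _ _ (nbhs_filter x)) => e e0.
have : \forall y \near x, forall i, `|'D_('e_i) f x - 'D_('e_i) f y| < e / 2.
  apply: (filter_forall (nbhs_filter x)) => i; have [_ [+ _]] := H 'e_i (ex_intro2 _ _ i I erefl).
  by move=> /(_ x)/cvgrPdist_lt; apply; rewrite divr_gt0.
apply: filterS => y Hy; apply: (@le_lt_trans _ _ (e / 2)); last by lra.
by apply: norm_le_coord => [|i]; [lra|rewrite !mxE ltW].
Qed.

Lemma C1_space_taylor (f : 'rV[R]_d -> R) (N e : R) : C1_space f -> 0 < e ->
  exists2 r, 0 < r & forall x y, `|x| <= N -> `|y - x| < r ->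
    `|f y - f x - dotr (grad f x) (y - x)| <= e * `|y - x|.
Proof.
move=> cf e0; pose K := [set x : 'rV[R]_d | `|x| <= N + 1].
have e'0 : 0 < e / d.+1%:R by rewrite divr_gt0.
have [r r0 H] := compact_uniform (@compact_norm_le R d (N + 1))
  (continuous_subspaceT (C1_space_grad cf)) e'0.
exists (Num.min 1 r); first by rewrite lt_min ltr01.
move=> x y xN; rewrite lt_min => /andP[yx1 yxr].
apply: le_trans (space_increment (Df := grad f) (e := e / d.+1%:R) _ _) _.
- move=> z i; rewrite mxE; apply/derivableP; have [_ /(_ 'e_i)] := cf.
  by case; [exists i|].
- move=> z zx; rewrite distrC ltW//; apply: H => /=; first lra.
    by rewrite -(subrK x z); apply: le_trans (ler_normD _ _) _; lra.
  by rewrite distrC (le_lt_trans zx).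
- by rewrite ler_wpM2r// mulrA ler_pdivrMr// mulrC ler_pM2l// ler_nat.
Qed.

End Taylor.

(** * The Euler scheme *)

Fixpoint euler {R : realType} {d : nat} (f : 'rV[R]_d * R -> 'rV[R]_d) (h : R)
    (i : nat) (x : 'rV[R]_d) : 'rV[R]_d :=
  if i is j.+1 then
    euler f h j x + h *: f (euler f h j x, j%:R * h)
  else x.

Section Euler.
Context {R : realType} {d : nat}.
Variables (f : 'rV[R]_d * R -> 'rV[R]_d) (T : R).
Hypotheses (T_gt0 : 0 < T) (f_cont : continuous f).

Lemma euler_continuous h i : continuous (euler f h i).
Proof.
elim: i => [|i IH] x /=; first exact: cvg_id.
have Hx := nbhs_filter x.
apply: (@cvgD _ _ _ _ Hx (euler f h i)
  (fun x => h *: f (euler f h i x, i%:R * h))); first exact: IH.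
apply: (@cvgZl_tmp _ _ _ _ Hx).
apply: (@continuous_comp _ _ _ (fun x => (euler f h i x, i%:R * h)) f).
  exact: (@cvg_pair _ _ _ _ _ _ Hx (nbhs_filter _) (nbhs_filter _) _ _ (IH x)
    (@cvg_cst _ _ _ _ Hx)).
exact: f_cont.
Qed.

(** Discrete Gronwall inequality, from [1 + C h <= exp (C h)]. It is applied both to the size of the
    polygon and to [V + 1]. *)
Lemma growth_iter (a : nat -> R) (C h : R) n : 0 <= C -> 0 <= h ->
  n%:R * h <= T -> (forall i, 0 <= a i) ->
  (forall i, (i < n)%N -> a i.+1 <= (1 + C * h) * a i) ->
  forall i, (i <= n)%N -> a i <= expR (C * T) * a 0%N.
Proof.
move=> C0 h0 nhT a0 aS i ni.
apply: (@le_trans _ _ (expR (C * h) ^+ i * a 0%N)); last first.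
  rewrite ler_wpM2r// -expRM_natl ler_expR mulrCA ler_wpM2l//.
  by apply: le_trans nhT; rewrite ler_wpM2r// ler_nat.
elim: i ni => [|i IH] ni; first by rewrite expr0 mul1r.
apply: le_trans (aS i ni) _; rewrite exprS -mulrA ler_pM//.
- by rewrite addr_ge0// mulr_ge0.
- exact: expR_ge1Dx.
- by apply: IH; exact: ltnW.
Qed.

Variables (V : 'rV[R]_d -> R) (C3 : R).
Hypotheses (V_gt0 : forall x, 0 < V x) (V_C1 : C1_space V).
Hypothesis V_lyapunov : forall x t, 0 <= t <= T ->
  dotr (f (x, t)) (grad V x) <= C3 * V x.
Variable G : R.
Hypothesis f_growth : forall x t, 0 <= t <= T -> `|f (x, t)| <= G * (1 + `|x|).

(** Linear growth confines every polygon starting in the ball of radius [N] to the ball of radius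
    [rho], whatever the step. Only then is the step chosen, by the bound of [f] and the uniform
    Taylor expansion of [V] on that ball. Working with [V + 1] absorbs the error of size [h] per
    step without any positive lower bound for [V]. *)
Lemma euler_good_step N e : 0 < e -> exists2 n, (0 < n)%N &
  let h := T / n%:R in h <= e /\
  forall x, `|x| <= N -> 
    (forall i, (i < n)%N -> `|euler f h i.+1 x - euler f h i x| <= e) /\
    (forall i, (i <= n)%N ->
       V (euler f h i x) + 1 <= expR ((`|C3| + 1) * T) * (V x + 1)).
Proof.
move=> e0; pose rho := expR (`|G| * T) * (1 + `|N|).
have fc : {within [set x : 'rV[R]_d | `|x| <= rho] `*` `[0, T], continuous f}.
  exact: continuous_subspaceT.
have [B B0 HB] := compact_bound (@compact_slab R d rho 0 T) fc.
have B'0 : 0 < B^-1 by rewrite invr_gt0.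
(* One step has length at most [h * B], so tolerance [B^-1] makes the Taylor error of [V] at most
   [h]. *)
have [r r0 Hr] := C1_space_taylor rho V_C1 B'0.
have [n n0 [hn1 hn2 hn3]] : exists2 n, (0 < n)%N &
    [/\ T / n%:R <= e, T / n%:R * B <= e & T / n%:R * B < r].
  (* Each of the three conditions on [T / n] says that [n] exceeds one of these nonnegative
     summands. *)
  pose M := T / e + T * B / e + T * B / r.
  have M0 : 0 <= M by rewrite !addr_ge0 ?divr_ge0 ?mulr_ge0 ?ltW.
  exists (Num.truncn M).+1 => //.
  have /andP[_ HM] := truncn_itv M0.
  have k0 : 0 < (Num.truncn M).+1%:R :> R by rewrite ltr0n.
  have p1 : 0 <= T / e by rewrite divr_ge0 ?ltW.
  have p2 : 0 <= T * B / e by rewrite divr_ge0 ?mulr_ge0 ?ltW.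
  have p3 : 0 <= T * B / r by rewrite divr_ge0 ?mulr_ge0 ?ltW.
  split.
  - rewrite ler_pdivrMr// [e * _]mulrC -ler_pdivrMr//.
    refine (le_trans _ (ltW HM)); rewrite /M; lra.
  - rewrite mulrAC ler_pdivrMr// [e * _]mulrC -ler_pdivrMr//.
    refine (le_trans _ (ltW HM)); rewrite /M; lra.
  - rewrite mulrAC ltr_pdivrMr// [r * _]mulrC -ltr_pdivrMr//.
    refine (le_lt_trans _ HM); rewrite /M; lra.
exists n => //; set h := T / n%:R; split => // x xN.
have h0 : 0 < h by rewrite divr_gt0 ?ltr0n.
have nh : n%:R * h <= T by rewrite /h mulrC divfK// pnatr_eq0 -lt0n.
have tT i : (i < n)%N -> 0 <= i%:R * h <= T.
  move=> ni; rewrite mulr_ge0 ?(ltW h0)//=; apply: le_trans nh.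
  by rewrite ler_wpM2r ?(ltW h0)// ler_nat ltnW.
set X := fun i => euler f h i x.
have stepE i : X i.+1 - X i = h *: f (X i, i%:R * h) by rewrite /X /= addrC addKr.
have bnd i : (i <= n)%N -> `|X i| <= rho.
  move=> ni; suff : 1 + `|X i| <= rho by apply: le_trans; rewrite lerDr.
  have st0 j : (j < n)%N -> 1 + `|X j.+1| <= (1 + `|G| * h) * (1 + `|X j|).
    move=> jn; rewrite -(subrK (X j) (X j.+1)) stepE.
    apply: (@le_trans _ _ (1 + (h * (`|G| * (1 + `|X j|)) + `|X j|))).
      rewrite lerD2l; apply: le_trans (ler_normD _ _) _; rewrite lerD2r normrZ gtr0_norm//.
      rewrite ler_pM2l//; apply: le_trans (f_growth _ (tT _ jn)) _.
      by rewrite ler_wpM2r ?addr_ge0// ler_norm.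
    by rewrite le_eqVlt; apply/orP; left; apply/eqP; ring.
  have a0 j : 0 <= 1 + `|X j| by rewrite addr_ge0.
  apply: le_trans (growth_iter (normr_ge0 G) (ltW h0) nh a0 st0 ni) _.
  by rewrite ler_wpM2l ?expR_ge0// lerD2l (le_trans xN)// ler_norm.
have fB i : (i < n)%N -> `|f (X i, i%:R * h)| <= B.
  move=> ni; apply: HB; split => /=; first exact/bnd/ltnW.
  by rewrite in_itv /=; exact: tT.
have stB i : (i < n)%N -> `|X i.+1 - X i| <= h * B.
  by move=> ni; rewrite stepE normrZ gtr0_norm// ler_pM2l// fB.
split.
  by move=> i ni; apply: le_trans (stB i ni) _.
apply: growth_iter (ltW h0) nh _ _ => //.
  by move=> i; rewrite addr_ge0 ?ltW.
move=> i ni.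
have /ler_normlP[_ H] := Hr (X i) (X i.+1) (bnd _ (ltnW ni)) (le_lt_trans (stB i ni) hn3).
have h1 : B^-1 * `|X i.+1 - X i| <= h.
  by rewrite mulrC ler_pdivrMr// stB.
have h2 : dotr (grad V (X i)) (X i.+1 - X i) <= h * (`|C3| * V (X i)).
  rewrite stepE dotrZr ler_pM2l// dotrC; apply: le_trans (V_lyapunov _ (tT _ ni)) _.
  by rewrite ler_pM2r// ler_norm.
have Vi := V_gt0 (X i).
rewrite -/(X i) -/(X i.+1).
have -> : (1 + (`|C3| + 1) * h) * (V (X i) + 1) =
  V (X i) + h * (`|C3| * V (X i)) + h + 1 + (h * `|C3| + h * V (X i)) by ring.
have : 0 <= h * `|C3| + h * V (X i) by rewrite addr_ge0 ?mulr_ge0// ltW.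
lra.
Qed.

End Euler.

(** * Convergence criteria for real sequences, and truncation *)

Section RealSequences.
Context {R : realType}.
Implicit Types a : nat -> R.

Lemma cauchy_real_cvg a :
  (forall e, 0 < e -> exists l, \forall j \near \oo, `|l - a j| < e) ->
  cvgn a.
Proof.
move=> H; apply/cauchy_cvgP; apply: cauchy_exP => e e0.
by have [l Hl] := H e e0; exists l; rewrite -ball_normE.
Qed.

(** The limit is the supremum of the eventual lower bounds. A rational number strictly above that
    supremum is not an eventual lower bound, so the sequence is eventually below it. *)
Lemma eventually_separated_cvg a M : (forall j, `|a j| <= M) ->
  (forall q : rat, (\forall j \near \oo, a j < ratr q) \/
                   (\forall j \near \oo, ~ a j < ratr q)) ->
  cvgn a.
Proof.
move=> aM Hq; pose S := [set r | \forall j \near \oo, r <= a j].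
have SM : S (- M) by near=> j; have := aM j; rewrite ler_norml => /andP[].
have Sub r : S r -> r <= M.
  move=> Sr; near \oo => j; apply: (@le_trans _ _ (a j)); first by near: j.
  by have := aM j; rewrite ler_norml => /andP[].
have supS : has_sup S by split; [exists (- M)|exists M => r /Sub].
apply: cauchy_real_cvg => e e0; exists (sup S).
have [r Sr rS] := sup_adherent e0 supS.
have [q] := @rat_in_itvoo R (sup S) (sup S + e) ltac:(lra).
rewrite in_itv /= => /andP[q1 q2].
case: (Hq q) => Hq'; last first.
  suff : ratr q <= sup S by rewrite leNgt q1.
  apply: ub_le_sup; first by case: supS.
  by apply: filterS Hq' => j /negP; rewrite -leNgt.
apply: filterS2 Sr Hq' => j h1 h2.
by rewrite ltr_norml; apply/andP; split; lra.
Unshelve. all: by end_near. Qed.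

Definition clamp (x c : R) := Num.max (- c) (Num.min x c).

(** The level varies too, because [probe] clamps a coordinate by a level that depends on the
    point. *)
Lemma clamp_lip x y c c' e : `|x - y| <= e -> `|c - c'| <= e ->
  `|clamp x c - clamp y c'| <= e.
Proof.
rewrite /clamp !ler_norml => /andP[? ?] /andP[? ?].
case: (leP x c) => ?; case: (leP y c') => ?;
  case: (leP (- c) _) => ?; case: (leP (- c') _) => ?; apply/andP; split; lra.
Qed.

Lemma norm_clamp x c : 0 <= c -> `|clamp x c| <= c.
Proof.
rewrite /clamp ler_norml le_max lexx/= ge_max ge_min lexx orbT andbT; lra.
Qed.

Lemma clamp_id x c : `|x| <= c -> clamp x c = x.
Proof.
rewrite /clamp ler_norml => /andP[cx xc].
by rewrite (min_idPl xc); apply/max_idPr.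
Qed.

End RealSequences.

(* The functions [probe N o], [N : nat], separate the points of the one-point
   compactification of R^d. *)
Section Probes.
Context {R : realType} {d : nat}.
Implicit Types x y z : 'rV[R]_d.

Definition bump (N : nat) z : R := Num.max 0 (N%:R - `|z|).

Definition probe (N : nat) (o : option 'I_d) z : R :=
  if o is Some i then clamp (z 0 i) (bump N z) else bump N z.

Lemma bump_ge0 N z : 0 <= bump N z.
Proof. by rewrite /bump le_max lexx. Qed.

Lemma bump_lip N x y : `|bump N x - bump N y| <= `|x - y|.
Proof.
have h1 : `|x| <= `|y| + `|x - y| by rewrite -{1}(subrK y x) addrC ler_normD.
have h2 : `|y| <= `|x| + `|x - y| by rewrite -{1}(subrK x y) addrC distrC ler_normD.
rewrite /bump ler_norml.
by case: (leP 0 (N%:R - `|x|)) => ?; case: (leP 0 (N%:R - `|y|)) => ?;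
  apply/andP; split; lra.
Qed.

Lemma probe_lip N o x y : `|probe N o x - probe N o y| <= `|x - y|.
Proof.
case: o => [i|] /=; last exact: bump_lip.
apply: clamp_lip; last exact: bump_lip.
by have := coord_le_norm (x - y) i; rewrite !mxE.
Qed.

Lemma probe_bound N o z : `|probe N o z| <= N%:R.
Proof.
have bN : bump N z <= N%:R.
  by rewrite /bump ge_max ler0n/= lerBlDr lerDl.
case: o => [i|] /=; last by rewrite ger0_norm ?bump_ge0.
by apply: le_trans bN; apply: norm_clamp; exact: bump_ge0.
Qed.

Lemma probe_support N o z : N%:R <= `|z| -> probe N o z = 0.
Proof.
move=> Nz; have b0 : bump N z = 0 by rewrite /bump; apply/max_idPl; rewrite subr_le0.
case: o => [i|] //=; rewrite b0; have := norm_clamp (z 0 i) (lexx 0).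
by rewrite normr_le0 => /eqP.
Qed.

Lemma probe_continuous N o : continuous (probe N o : 'rV[R]_d -> R).
Proof.
move=> x; apply/(@cvgrPdist_lt R _ _ _ (nbhs_filter x)) => e e0.
apply/nbhs_ballP; exists e => //= y; rewrite -ball_normE /= => xy.
by apply: le_lt_trans xy; exact: probe_lip.
Qed.

Lemma rV_cvg_coord (z : nat -> 'rV[R]_d) (y : 'rV[R]_d) :
  (forall i, z j 0 i @[j --> \oo] --> y 0 i) -> z j @[j --> \oo] --> y.
Proof.
move=> H; apply/cvgrPdist_lt => e e0.
have : \forall j \near \oo, forall i, `|y 0 i - z j 0 i| < e / 2.
  apply: (filter_forall eventually_filter) => i.
  by have /cvgrPdist_lt := H i; apply; rewrite divr_gt0.
apply: filterS => j Hj; apply: (@le_lt_trans _ _ (e / 2)); last by lra.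
by apply: norm_le_coord => [|i]; [lra|rewrite !mxE ltW].
Qed.

(** A positive limit of some [bump N] traps the sequence in the ball of radius [N], where the
    coordinates can be read off. If there is none, every [bump N.+1] is eventually less than 1, that
    is, the norm exceeds [N]. *)
Lemma probe_dichotomy (z : nat -> 'rV[R]_d) :
  (forall N o, cvgn (fun j => probe N o (z j))) ->
  (exists y, z j @[j --> \oo] --> y) \/
  (forall N : nat, \forall j \near \oo, N%:R < `|z j|).
Proof.
move=> H; have [[N HN]|HN] :=
    pselect (exists N, 0 < limn (fun j => probe N None (z j))); [left|right].
- have zN : \forall j \near \oo, `|z j| < N%:R.
    have := H N None => /cvgr_gt/(_ _ HN); apply: filterS => j.
    by rewrite ltNge => h; rewrite ltNge; apply: contra h => /probe_support ->.
  (* On the ball of radius [N] the level [bump (2 * N)] is at least [N], so clamping leaves the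
     coordinates unchanged. *)
  exists (\row_i limn (fun j => probe (2 * N) (Some i) (z j))).
  apply: rV_cvg_coord => i; rewrite mxE.
  have := H (2 * N)%N (Some i).
  apply: cvg_trans; apply: near_eq_cvg.
  apply: filterS zN => j zN /=; apply/esym; rewrite clamp_id//.
  apply: le_trans (coord_le_norm _ _) _; rewrite /bump le_max.
  by apply/orP; right; rewrite natrM; lra.
- move=> N; have := H N.+1 None.
  have : limn (fun j => probe N.+1 None (z j)) < 1.
    rewrite ltNge; apply/negP => h; apply: HN; exists N.+1.
    by apply: lt_le_trans h.
  move=> l1 /cvgr_lt/(_ _ l1); apply: filterS => j /=.
  rewrite /bump gt_max => /andP[_]; rewrite -natr1; lra.
Qed.

End Probes.

(** * Measurability and integration of step functions *)

Section Switch.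
Context d d' (X : measurableType d) (Y : measurableType d').

Lemma measurable_switch (f : X -> nat) (g : nat -> X -> Y) :
  (forall n, measurable (f @^-1` [set n])) ->
  (forall n, measurable_fun setT (g n)) ->
  measurable_fun setT (fun x => g (f x) x).
Proof.
move=> mf mg _ B mB; rewrite setTI.
have -> : (fun x => g (f x) x) @^-1` B =
    \bigcup_n (f @^-1` [set n] `&` (g n @^-1` B)).
  apply/seteqP; split => x /=; first by exists (f x).
  by move=> [n _ [/= <-]].
apply: bigcupT_measurable => n; apply: measurableI => //.
by have := mg n measurableT B mB; rewrite setTI.
Qed.

End Switch.

Section StepFunctions.
Context {R : realType}.
Local Notation leb := (@lebesgue_measure R).

Lemma measurable_truncn_div (h : R) n : 0 < h ->
  measurable ((fun t : measurableTypeR R => Num.truncn (t / h)) @^-1` [set n]).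
Proof.
move=> h0.
have mle m : measurable
    ((fun t : measurableTypeR R => Num.truncn (t / h)) @^-1` [set k | (k <= m)%N]).
  (* Truncation sends negative numbers to 0, so this interval is unbounded to the left. *)
  rewrite (_ : _ @^-1` _ = `]-oo, m.+1%:R * h[%classic); first exact: measurable_itv.
  apply/seteqP; split => t /=; rewrite in_itv/= truncn_le_nat ltr_pdivrMr//.
case: n => [|n].
  rewrite (_ : [set 0%N] = [set k | (k <= 0)%N]); first exact: mle.
  by apply/seteqP; split => k /=; rewrite leqn0 => /eqP.
rewrite (_ : [set n.+1] = [set k | (k <= n.+1)%N] `\` [set k | (k <= n)%N]).
  by apply: (measurableD (mle n.+1) (mle n)).
apply/seteqP; split => k /=; first by move=> ->; rewrite ltnn.
by move=> [kn /negP]; rewrite -ltnNge => nk; apply/eqP; rewrite eqn_leq kn nk.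
Qed.

Lemma integrable_cst_itv (i : interval R) (c : R) :
  (leb [set` i] < +oo)%E -> leb.-integrable [set` i] (cst c%:E).
Proof.
move=> li; have mi : measurable ([set` i] : set (measurableTypeR R)).
  exact: measurable_itv.
apply/integrableP; split; first exact: measurable_cst.
by rewrite (eq_integral (cst `|c|%:E))// integral_cst//= lte_mul_pinfty.
Qed.

Lemma segment_measure (a b : R) : (leb `[a, b] < +oo)%E.
Proof.
by rewrite lebesgue_measure_itv/= lte_fin; case: ifP => _; rewrite ?ltry// -EFinB ltry.
Qed.

Lemma integral_step (g : nat -> R) (h : R) k : 0 < h ->
  (\int[leb]_(s in `[0%R, (k%:R * h)%R[) (g (Num.truncn (s / h)))%:E =
   (\sum_(i < k) h * g i)%:E)%E.
Proof.
move=> h0.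
have mg D : measurable_fun D (fun s : measurableTypeR R => (g (Num.truncn (s / h)))%:E).
  apply: measurable_funTS.
  apply: (@measurable_switch _ _ (measurableTypeR R) _ _ (fun n _ => (g n)%:E)) => n.
    exact: measurable_truncn_div.
  exact: measurable_cst.
elim: k => [|k IH].
  by rewrite mul0r set_itvco0 integral_set0 big_ord0.
have kk : k%:R * h <= k.+1%:R * h by rewrite ler_pM2r// ler_nat.
have -> : `[0%R, (k.+1%:R * h)%R[%classic =
    `[0%R, (k%:R * h)%R[%classic `|` `[(k%:R * h)%R, (k.+1%:R * h)%R[%classic.
  apply/seteqP; split => s /=; rewrite !in_itv/=.
    by move=> /andP[-> ->] /=; case: ltP => _; [left|right].
  move=> [/andP[-> /lt_le_trans ->]//|/andP[ks ->]].
  by rewrite andbT (le_trans _ ks)// mulr_ge0 ?(ltW h0).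
rewrite integral_setU//; last first.
  rewrite disj_set2E; apply/eqP/seteqP; split => // s [] /=; rewrite !in_itv/=.
  by move=> /andP[_ h1] /andP[h2 _]; move: (lt_le_trans h1 h2); rewrite ltxx.
rewrite IH big_ord_recr/= EFinD; congr (_ + _)%E.
rewrite (eq_integral (cst (g k)%:E)); last first.
  move=> s; rewrite inE /= in_itv/= => /andP[h1 h2]; congr (_%:E); congr g.
  by apply: truncn_def; rewrite ler_pdivlMr// ltr_pdivrMr// h1.
rewrite integral_cst//= lebesgue_measure_itv/= lte_fin ltr_pM2r// ltr_nat ltnSn.
by rewrite -EFinB -EFinM -natr1 mulrDl mul1r addrAC subrr add0r mulrC.
Qed.

End StepFunctions.

Section SequentialLimits.
Context {R : realType}.

Lemma within_cvg_seq (V W : normedModType R) (A : set V) (g : V -> W)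
    (z : nat -> V) (l : V) :
  {within A, continuous g} -> A l -> (\forall j \near \oo, A (z j)) ->
  z j @[j --> \oo] --> l -> g (z j) @[j --> \oo] --> g l.
Proof.
move=> /within_continuousE cg Al Az zl; apply/cvgrPdist_lt => e e0.
have [r r0 rP] := cg l Al e e0.
have /cvgrPdist_lt/(_ r r0) := zl.
by apply: filterS2 Az => j Aj lz; exact: rP.
Qed.

Context {d : nat}.

Lemma cvg_coord (S : Type) (F : set_system S) {FF : Filter F}
    (z : S -> 'rV[R]_d) (l : 'rV[R]_d) i :
  z j @[j --> F] --> l -> z j 0 i @[j --> F] --> l 0 i.
Proof.
move=> /cvgrPdist_lt zl; apply/cvgrPdist_lt => e e0.
apply: filterS (zl e e0) => j; apply: le_lt_trans.
by have := coord_le_norm (l - z j) i; rewrite !mxE.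
Qed.

Lemma cvg_dotr (S : Type) (F : set_system S) {FF : Filter F}
    (z w : S -> 'rV[R]_d) (l m : 'rV[R]_d) :
  z j @[j --> F] --> l -> w j @[j --> F] --> m ->
  dotr (z j) (w j) @[j --> F] --> dotr l m.
Proof.
move=> zl wm; rewrite /dotr.
apply: cvg_big => [|i _]; first exact: add_continuous.
by apply: cvgM; exact: cvg_coord.
Qed.

Lemma cvg_pair_seq (z : nat -> 'rV[R]_d) (s : nat -> R) (l : 'rV[R]_d) (t : R) :
  z j @[j --> \oo] --> l -> s j @[j --> \oo] --> t ->
  (z j, s j) @[j --> \oo] --> (l, t).
Proof.
move=> /cvgrPdist_lt zl /cvgrPdist_lt st; apply/cvgrPdist_lt => e e0.
by apply: filterS2 (zl e e0) (st e e0) => j; exact: pair_norm_lt.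
Qed.

End SequentialLimits.

(** * Limits of Euler paths *)

Section EulerPaths.
Context {R : realType} {d : nat}.
Variables (T : R) (b : 'rV[R]_d * R -> 'rV[R]_d).
Variables (n : nat -> nat) (bb : nat -> 'rV[R]_d * R -> 'rV[R]_d).
Variable p : nat -> nat -> 'rV[R]_d.

Let h j := T / (n j)%:R.

Hypotheses (T_gt0 : 0 < T) (n_gt0 : forall j, (0 < n j)%N).
Hypothesis h_cvg0 : forall e, 0 < e -> \forall j \near \oo, h j < e.
Hypothesis b_cont : {within setT `*` `[0, T], continuous b}.
Hypothesis bb_cvg : forall N e, 0 < e -> \forall j \near \oo,
  forall x t, `|x| <= N -> 0 <= t <= T -> `|b (x, t) - bb j (x, t)| < e.
Hypothesis p_step : forall j i,
  p j i.+1 = p j i + h j *: bb j (p j i, i%:R * h j).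
Hypothesis p_step_le1 : \forall j \near \oo,
  forall i, (i < n j)%N -> `|p j i.+1 - p j i| <= 1.

Definition node j t := Num.truncn (t / h j).
(** The path is kept piecewise constant: each of its values is a node of the scheme, and time
    integrals along it are exactly finite sums. *)
Definition step_path j t := p j (node j t).

Lemma step_gt0 j : 0 < h j.
Proof. by rewrite divr_gt0// ltr0n. Qed.

Lemma node_itv j t : 0 <= t -> (node j t)%:R * h j <= t < (node j t).+1%:R * h j.
Proof.
move=> t0; have := @truncn_itv R (t / h j) (divr_ge0 t0 (ltW (step_gt0 j))).
by rewrite ler_pdivlMr ?step_gt0// ltr_pdivrMr ?step_gt0.
Qed.

Lemma node_le j t : 0 <= t <= T -> (node j t <= n j)%N.
Proof.
move=> /andP[t0 tT]; have /andP[h1 _] := node_itv j t0.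
rewrite -(ler_nat R) -(ler_pM2r (step_gt0 j)); apply: le_trans h1 _.
by rewrite /h mulrC divfK// pnatr_eq0 -lt0n.
Qed.

Lemma node_time j i : (i <= n j)%N -> 0 <= i%:R * h j <= T.
Proof.
move=> ni; rewrite mulr_ge0 ?(ltW (step_gt0 j))//=.
apply: (@le_trans _ _ ((n j)%:R * h j)).
  by rewrite ler_wpM2r ?(ltW (step_gt0 j))// ler_nat.
by rewrite /h mulrC divfK// pnatr_eq0 -lt0n.
Qed.

Lemma le_node j s t : s <= t -> (node j s <= node j t)%N.
Proof. by move=> st; apply: le_truncn; rewrite ler_pM2r// invr_gt0 step_gt0. Qed.

Lemma field_bound N : exists2 B, 0 < B & \forall j \near \oo,
  forall x t, `|x| <= N -> 0 <= t <= T -> `|bb j (x, t)| <= B.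
Proof.
have cb : {within [set x : 'rV[R]_d | `|x| <= N] `*` `[0, T], continuous b}.
  by apply: continuous_subspaceW b_cont => -[x t] [].
have [B B0 HB] := compact_bound (@compact_slab R d N 0 T) cb.
exists (B + 1); first by rewrite addr_gt0.
apply: filterS (bb_cvg N ltr01) => j Hj x t xN tT.
have h1 := Hj x t xN tT.
have h2 : `|b (x, t)| <= B by apply: HB; split => //=; rewrite in_itv.
rewrite -[bb j (x, t)](subKr (b (x, t))).
by apply: le_trans (ler_normB _ _) _; lra.
Qed.

Lemma telescope_le (F : nat -> R) c m i i' : (i <= i')%N -> (i' <= m)%N ->
  (forall k, (k < m)%N -> `|F k.+1 - F k| <= c) ->
  `|F i' - F i| <= (i' - i)%:R * c.
Proof.
move=> + + Fc; elim: i' => [|i' IH].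
  by rewrite leqn0 => /eqP -> _; rewrite subrr normr0 mul0r.
rewrite leq_eqVlt => /predU1P[->|ii'] i'm; first by rewrite subrr normr0 subnn mul0r.
rewrite subSn// -natr1 mulrDl mul1r -(subrK (F i') (F i'.+1)) -addrA.
apply: le_trans (ler_normD _ _) _; rewrite [leLHS]addrC lerD ?Fc//.
by apply: IH => //; exact: ltnW.
Qed.

(** From a node in the ball of radius [N + 1] a step has length at most [B * h j]. From a node
    outside it, a step of length at most 1 still ends outside the ball of radius [N], so the probe
    is 0 at both ends. The extra [h j] comes from rounding times to nodes. *)
Lemma probe_equicontinuous N o : exists2 C, 0 < C & \forall j \near \oo,
  forall s t, 0 <= s -> s <= t -> t <= T ->
    `|probe N o (step_path j t) - probe N o (step_path j s)| <= C * (t - s + h j).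
Proof.
have [B B0 HB] := field_bound (N.+1)%:R; exists B => //.
apply: filterS2 HB p_step_le1 => j HB Hle1 s t s0 st tT.
have tT' : 0 <= t <= T by rewrite tT andbT (le_trans s0).
have h0 := step_gt0 j.
have inc k : (k < n j)%N -> `|probe N o (p j k.+1) - probe N o (p j k)| <= B * h j.
  move=> kn; have [pN|pN] := leP `|p j k| (N.+1)%:R.
    apply: le_trans (probe_lip _ _ _ _) _.
    rewrite p_step addrC addKr normrZ gtr0_norm// mulrC ler_pM2r//.
    by apply: HB => //; apply: node_time; exact: ltnW.
  have h1 := Hle1 k kn.
  have h2 : `|p j k| <= `|p j k.+1| + `|p j k.+1 - p j k|.
    by rewrite -{1}(subrK (p j k.+1) (p j k)) addrC distrC ler_normD.
  rewrite -natr1 in pN.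
  rewrite probe_support; last by lra.
  rewrite probe_support; last by lra.
  by rewrite subrr normr0 mulr_ge0// ltW.
apply: le_trans (telescope_le (F := fun k => probe N o (p j k))
  (le_node j st) (node_le j tT') inc) _.
rewrite mulrCA ler_pM2l// natrB ?le_node//.
have /andP[h1 h2] := node_itv j s0.
have /andP[h3 h4] := node_itv j (le_trans s0 st).
by rewrite mulrBl; move: h2; rewrite -natr1 mulrDl mul1r; lra.
Qed.

Lemma path_probe_cvg :
  (forall q : rat, 0 <= (ratr q : R) <= T ->
     forall N o, cvgn (fun j => probe N o (step_path j (ratr q)))) ->
  forall t, 0 <= t <= T -> forall N o, cvgn (fun j => probe N o (step_path j t)).
Proof.
move=> Hq t tT N o; apply: cauchy_real_cvg => e e0.
have [C C0 HC] := probe_equicontinuous N o.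
(* Moving from [t] to a rational time within [e'] costs [C * (e' + h j)], less than two thirds of
   [e]; convergence at the rational time uses the last third. *)
have [e' e'0 Ce'] : exists2 e', 0 < e' & C * e' = e / 3.
  by exists (e / 3 / C); [rewrite !divr_gt0|rewrite mulrC divfK// gt_eqF].
have /andP[t0 tT'] := tT.
(* The interval is nonempty even for [t = 0] and [t = T], because [0 < T]. *)
have : Num.max 0 (t - e') < Num.min T (t + e').
  by have T0 := T_gt0; rewrite gt_max !lt_min; apply/andP; split; apply/andP; split; lra.
move=> /rat_in_itvoo[q]; rewrite in_itv /= gt_max lt_min.
move=> /andP[/andP[q0 q1] /andP[q2 q3]].
have qT : 0 <= (ratr q : R) <= T by apply/andP; split; lra.
exists (limn (fun j => probe N o (step_path j (ratr q)))).
have /cvgrPdist_lt/(_ (e / 3) ltac:(lra)) := Hq q qT N o.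
apply: filterS3 HC (h_cvg0 e'0) => j HC hj Hl.
have D : `|probe N o (step_path j (ratr q)) - probe N o (step_path j t)| <= C * (e' + e').
  have [tq|tq] := leP t (ratr q).
    by apply: le_trans (HC _ _ t0 tq _) _; [lra|rewrite ler_pM2l//; lra].
  rewrite distrC; apply: le_trans (HC _ _ _ (ltW tq) _) _; [lra|lra|].
  by rewrite ler_pM2l//; lra.
rewrite -(subrK (probe N o (step_path j (ratr q))) (limn _)) -addrA.
apply: le_lt_trans (ler_normD _ _) _.
by move: D; rewrite mulrDr Ce'; lra.
Qed.

Lemma path_dichotomy :
  (forall q : rat, 0 <= (ratr q : R) <= T ->
     forall N o, cvgn (fun j => probe N o (step_path j (ratr q)))) ->
  forall t, 0 <= t <= T ->
    (exists y : 'rV[R]_d, step_path j t @[j --> \oo] --> y) \/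
    (forall N : nat, \forall j \near \oo, N%:R < `|step_path j t|).
Proof. by move=> Hq t tT; apply: probe_dichotomy => N o; exact: path_probe_cvg. Qed.

Lemma node_time_cvg t : 0 <= t -> (node j t)%:R * h j @[j --> \oo] --> t.
Proof.
move=> t0; apply/cvgrPdist_lt => e e0; apply: filterS (h_cvg0 e0) => j hj.
have /andP[h1 h2] := node_itv j t0.
by rewrite ger0_norm ?subr_ge0//; move: h2; rewrite -natr1 mulrDl mul1r; lra.
Qed.

Variables (D : set R) (Y : R -> 'rV[R]_d) (x0 : 'rV[R]_d).
Hypothesis p_start : forall j, p j 0%N = x0.
Hypothesis path_lim : forall t, 0 <= t <= T ->
  (D t /\ step_path j t @[j --> \oo] --> Y t) \/
  (~ D t /\ forall N : nat, \forall j \near \oo, N%:R < `|step_path j t|).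

Variables (u ut : 'rV[R]_d * R -> R) (ux : 'rV[R]_d * R -> 'rV[R]_d) (r : R).
Hypothesis su : C1_slab T u ut ux.
Hypothesis u0 : forall x t, 0 <= t < T -> r < `|x| -> u (x, t) = 0.

Definition generator (f : 'rV[R]_d * R -> 'rV[R]_d) z := ut z + dotr (f z) (ux z).

(* The value is 0 where the limit path is at infinity, that is, off [D]. *)
Definition along (F : 'rV[R]_d * R -> R) t := if t \in D then F (Y t, t) else 0.

Lemma generator0 f x t : 0 <= t < T -> r < `|x| -> generator f (x, t) = 0.
Proof.
move=> tT rx; have [ut0 ux0] := slab_zero_derivatives su u0 tT rx.
rewrite /generator ut0 ux0 add0r /dotr big1// => i _.
by rewrite mxE mulr0.
Qed.

Lemma slab_sub t : t < T ->
  [set x : 'rV[R]_d | `|x| <= r] `*` `[0, t] `<=` setT `*` `[0, T[.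
Proof.
by move=> tT [x s] [_ /=]; rewrite !in_itv/= => /andP[-> /le_lt_trans ->].
Qed.

(** This bound serves as the dominating constant for the time integrals. It is taken on [[0, t]]
    with [t < T] because the derivatives of [u] are not controlled near [T]. *)
Lemma generator_bound t : t < T -> exists2 M, 0 < M & \forall j \near \oo,
  forall x s, 0 <= s <= t -> `|generator (bb j) (x, s)| <= M.
Proof.
move=> tT; have cK := @compact_slab R d r 0 t.
have [M1 M10 H1] := compact_bound cK (continuous_subspaceW (slab_sub tT) (slab_cont_t su)).
have [M2 M20 H2] := compact_bound cK (continuous_subspaceW (slab_sub tT) (slab_cont_x su)).
have [B B0 HB] := field_bound r.
have M0 : 0 < M1 + d%:R * B * M2.
  by rewrite (lt_le_trans M10)// lerDl !mulr_ge0// ltW.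
exists (M1 + d%:R * B * M2) => //.
apply: filterS HB => j HB x s /andP[s0 st].
have [xr|rx] := leP `|x| r; last first.
  by rewrite generator0 ?normr0 ?(ltW M0)// s0 (le_lt_trans st).
have Kxs : ([set x : 'rV[R]_d | `|x| <= r] `*` `[0, t]) (x, s).
  by split => //=; rewrite in_itv/= s0.
apply: le_trans (ler_normD _ _) _; rewrite lerD ?H1//.
apply: le_trans (norm_dotr_le _ _) _; rewrite ler_pM ?mulr_ge0 ?H2//.
by rewrite ler_wpM2l// HB// s0/= (le_trans st)// ltW.
Qed.

(** Consistency of the Euler scheme, uniform over all nodes: far from the support of [u] both ends
    of a step lie where [u] and its derivatives vanish, and elsewhere the fields are uniformly
    bounded. *)
Lemma step_increment t e : t < T -> 0 < e -> \forall j \near \oo,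
  forall i, (i.+1)%:R * h j <= t ->
    `|u (p j i.+1, (i.+1)%:R * h j) - u (p j i, i%:R * h j) -
      h j * generator (bb j) (p j i, i%:R * h j)| <= e * h j.
Proof.
move=> tT e0.
have [B B0 HB] := field_bound (r + 1).
have B1 : 0 < 1 + B by rewrite addr_gt0.
(* Time and space increments add up to at most [h j * (1 + B)], so tolerance [e / (1 + B)] yields an
   error [e * h j]. *)
have [rho rho0 H] := slab_taylor (r + 1) su tT (divr_gt0 e0 B1).
have rB : 0 < rho / (1 + B) by rewrite divr_gt0.
apply: filterS3 HB p_step_le1 (h_cvg0 rB) => j HB Hle1 hj i it.
have h0 := step_gt0 j.
have hB : h j * (1 + B) < rho by move: hj; rewrite ltr_pdivlMr.
have hrho : h j < rho by have := mulr_gt0 h0 B0; lra.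
have iS : (i.+1)%:R * h j = i%:R * h j + h j by rewrite -natr1 mulrDl mul1r.
have i0 : 0 <= i%:R * h j by rewrite mulr_ge0// ltW.
have iT : (i < n j)%N.
  rewrite -(ltr_nat R) -(ltr_pM2r h0); apply: lt_le_trans (_ : T <= _).
    by move: it; rewrite iS; lra.
  by rewrite /h mulrC divfK// pnatr_eq0 -lt0n.
have stE : p j i.+1 - p j i = h j *: bb j (p j i, i%:R * h j).
  by rewrite p_step addrC addKr.
have [pr|pr] := leP `|p j i| (r + 1); last first.
  have h1 := Hle1 i iT.
  have h2 : `|p j i| <= `|p j i.+1| + `|p j i.+1 - p j i|.
    by rewrite -{1}(subrK (p j i.+1) (p j i)) addrC distrC ler_normD.
  have tk : 0 <= i%:R * h j < T by apply/andP; split; lra.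
  have tk1 : 0 <= (i.+1)%:R * h j < T by apply/andP; split; lra.
  rewrite (u0 tk1) ?(u0 tk) ?(generator0 _ tk)//; try lra.
  by rewrite mulr0 !subr0 normr0 mulr_ge0// ltW.
have bB : `|bb j (p j i, i%:R * h j)| <= B.
  by apply: HB => //; apply: node_time; exact: ltnW.
have dp : `|p j i.+1 - p j i| <= h j * B by rewrite stE normrZ gtr0_norm// ler_pM2l.
have := H (p j i) (p j i.+1) (i%:R * h j) ((i.+1)%:R * h j) pr.
have -> : (i.+1)%:R * h j - i%:R * h j = h j by rewrite iS addrAC subrr add0r.
move=> /(_ ltac:(lra) i0 ltac:(lra) it hrho).
rewrite stE dotrZr -stE.
rewrite (_ : ut _ * h j + h j * dotr _ _ =
  h j * generator (bb j) (p j i, i%:R * h j)); last first.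
  by rewrite /generator dotrC; ring.
move=> h1; apply: le_trans h1 _.
rewrite mulrAC ler_pdivrMr// -mulrA ler_pM2l//; lra.
Qed.

Lemma step_telescope t e : t < T -> 0 < e -> \forall j \near \oo,
  forall k, k%:R * h j <= t ->
    `|u (p j k, k%:R * h j) - u (x0, 0) -
      \sum_(i < k) h j * generator (bb j) (p j i, i%:R * h j)| <= e * (k%:R * h j).
Proof.
move=> tT e0; apply: filterS (step_increment tT e0) => j H; elim => [|k IH] kt.
  by rewrite big_ord0 !mul0r p_start subrr subr0 normr0 mulr0.
have kS : (k.+1)%:R * h j = k%:R * h j + h j by rewrite -natr1 mulrDl mul1r.
have {}IH := IH ltac:(have := step_gt0 j; lra).
have := H k kt; rewrite big_ord_recr/= => h1.
rewrite [e * _](_ : _ = e * (k%:R * h j) + e * h j); last by rewrite kS mulrDr.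
rewrite (_ : _ - _ = (u (p j k, k%:R * h j) - u (x0, 0) -
      \sum_(i < k) h j * generator (bb j) (p j i, i%:R * h j)) +
   (u (p j k.+1, (k.+1)%:R * h j) - u (p j k, k%:R * h j) -
      h j * generator (bb j) (p j k, k%:R * h j))); last by ring.
by apply: le_trans (ler_normD _ _) _; exact: lerD.
Qed.

(** If the paths converge at time [t], the assumed convergence of [F] applies; if they escape to
    infinity, [F] is eventually 0 on them, which is the value of [along] off [D]. Node times never
    exceed [t], so they stay below [T]. *)
Lemma along_cvg (F : nat -> 'rV[R]_d * R -> R) G t : 0 <= t < T ->
  (forall (z : nat -> 'rV[R]_d * R), (forall j, 0 <= (z j).2 <= t) ->
     z j @[j --> \oo] --> (Y t, t) -> F j (z j) @[j --> \oo] --> G (Y t, t)) ->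
  (forall j x s, 0 <= s <= t -> r < `|x| -> F j (x, s) = 0) ->
  F j (step_path j t, (node j t)%:R * h j) @[j --> \oo] --> along G t.
Proof.
move=> /andP[t0 tT] Fcvg F0; rewrite /along.
have tT' : 0 <= t <= T by rewrite t0 ltW.
have nt j : 0 <= (node j t)%:R * h j <= t.
  by have /andP[-> _] := node_itv j t0; rewrite mulr_ge0 ?(ltW (step_gt0 j)).
have [[Dt pY]|[nDt pN]] := path_lim tT'.
  rewrite mem_set//; apply: (Fcvg (fun j => (step_path j t, (node j t)%:R * h j))) => //.
  by apply: cvg_pair_seq => //; exact: node_time_cvg.
rewrite memNset//; apply: cvg_near_cst.
apply: filterS (pN (Num.truncn `|r|).+1) => j Hj.
rewrite F0//; apply: lt_trans Hj; apply: le_lt_trans (ler_norm r) _.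
exact: truncnS_gt.
Qed.

Lemma u_cvg t : 0 <= t < T ->
  u (step_path j t, (node j t)%:R * h j) @[j --> \oo] --> along u t.
Proof.
move=> /andP[t0 tT]; apply: (along_cvg (F := fun=> u)); first by rewrite t0.
  move=> z zt; apply: within_cvg_seq (slab_cont su) _ _.
    by split => //=; rewrite in_itv/= t0.
  apply: nearW => j; split => //=; rewrite in_itv/=.
  by have /andP[-> /le_lt_trans ->] := zt j.
by move=> j x s /andP[s0 st]; apply: u0; rewrite s0 (le_lt_trans st).
Qed.

Lemma generator_cvg t : 0 <= t < T ->
  generator (bb j) (step_path j t, (node j t)%:R * h j) @[j --> \oo] -->
  along (generator b) t.
Proof.
move=> /andP[t0 tT]; apply: (along_cvg (F := fun j => generator (bb j))).
- by rewrite t0.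
- move=> z zt zY.
  have St : (setT `*` `[0, T[ : set ('rV[R]_d * R)) (Y t, t).
    by split => //=; rewrite in_itv/= t0.
  have Sz : \forall j \near \oo, (setT `*` `[0, T[ : set ('rV[R]_d * R)) (z j).
    apply: nearW => j; split => //=; rewrite in_itv/=.
    by have /andP[-> /le_lt_trans ->] := zt j.
  apply: cvgD; first exact: within_cvg_seq (slab_cont_t su) St Sz zY.
  apply: cvg_dotr; last exact: within_cvg_seq (slab_cont_x su) St Sz zY.
  have bz : b (z j) @[j --> \oo] --> b (Y t, t).
    apply: within_cvg_seq b_cont _ _ zY.
      by split => //=; rewrite in_itv/= t0 ltW.
    apply: nearW => j; split => //=; rewrite in_itv/=.
    by have /andP[-> /le_trans ->] := zt j; rewrite ?ltW.
  apply/cvgrPdist_lt => e e0.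
  have /cvgrPdist_lt/(_ 1 ltr01) zY1 := zY.
  have /cvgrPdist_lt/(_ (e / 2) ltac:(lra)) bz2 := bz.
  have e2 : 0 < e / 2 by lra.
  apply: filterS3 zY1 bz2 (bb_cvg (`|Y t| + 1) e2) => j h1 h2 h3.
  have zN : `|(z j).1| <= `|Y t| + 1.
    move: h1; rewrite prod_normE/= gt_max => /andP[h1 _].
    have -> : (z j).1 = Y t - (Y t - (z j).1) by rewrite opprB addrC subrK.
    by apply: le_trans (ler_normB _ _) _; rewrite lerD2l ltW.
  have zT : 0 <= (z j).2 <= T by have /andP[-> /le_trans ->] := zt j; rewrite ?ltW.
  have := h3 _ _ zN zT; rewrite -surjective_pairing => h4.
  rewrite -(subrK (b (z j)) (b (Y t, t))) -addrA.
  by apply: le_lt_trans (ler_normD _ _) _; lra.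
- by move=> j x s /andP[s0 st]; apply: generator0; rewrite s0 (le_lt_trans st).
Qed.

Local Notation leb := (@lebesgue_measure R).

(** The telescoped sums are integrals of step functions that are uniformly bounded and converge
    pointwise, so dominated convergence identifies their limit. *)
Lemma path_identity t : 0 <= t < T ->
  ((along u t)%:E = (u (x0, 0%R))%:E +
    \int[leb]_(s in `[0%R, t]) (along (generator b) s)%:E)%E.
Proof.
move=> /andP[t0 tT].
have [M M0 [J _ HM]] := generator_bound tT.
(* Shifting the index by [J] makes the bound [M] valid for every [j], as domination requires. *)
pose k j := node (j + J)%N t.
pose tau j := (k j)%:R * h (j + J)%N.
pose gam j i := generator (bb (j + J)%N) (p (j + J)%N i, i%:R * h (j + J)%N).
(* Cutting at the last node [tau j <= t] makes the integral exactly the telescoped sum; each fixed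
   [s < t] lies before [tau j] as soon as the step is below [t - s]. *)
pose f_ j (s : measurableTypeR R) : \bar R :=
  ((fun s => (gam j (node (j + J)%N s))%:E) \_ `[0, tau j[%classic) s.
have mgam j : measurable_fun setT
    (fun s : measurableTypeR R => (gam j (node (j + J)%N s))%:E).
  apply: (@measurable_switch _ _ (measurableTypeR R) _ _ (fun n _ => (gam j n)%:E)) => i.
    by apply: measurable_truncn_div; exact: step_gt0.
  exact: measurable_cst.
have mf_ j : measurable_fun `[0, t[ (f_ j).
  apply: measurable_funTS; apply/(measurable_restrictT _ (measurable_itv _)).
  exact: measurable_funTS (mgam j).
have tau_t j : tau j <= t < tau j + h (j + J)%N.
  by have := node_itv (j + J)%N t0; rewrite -natr1 mulrDl mul1r.
have If_ j : (\int[leb]_(s in `[0%R, t[) f_ j s =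
    (\sum_(i < k j) h (j + J)%N * gam j i)%:E)%E.
  rewrite -integral_mkcondr (_ : _ `&` _ = `[0, tau j[%classic); last first.
    apply/seteqP; split => s /=; rewrite !in_itv/=; first by case.
    move=> /andP[s0 st]; rewrite s0 st; split => //=.
    by apply: lt_le_trans st _; have /andP[] := tau_t j.
  by rewrite /tau -(integral_step (gam j) (k j) (step_gt0 _)).
have f_cvg s : `[0, t[%classic s -> f_ j s @[j --> \oo] --> (along (generator b) s)%:E.
  rewrite /= in_itv/= => /andP[s0 st].
  have sT : 0 <= s < T by rewrite s0 (lt_trans st).
  have : (gam j (node (j + J)%N s))%:E @[j --> \oo] --> (along (generator b) s)%:E.
    apply: cvg_EFin; first exact: nearW.
    have := generator_cvg sT.
    by rewrite -(cvg_shiftn J).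
  apply: cvg_trans; apply: near_eq_cvg.
  have ts : 0 < t - s by rewrite subr_gt0.
  have [J' _ HJ'] := h_cvg0 ts.
  exists J' => // j /= J'j; rewrite /f_ patchE mem_set//= in_itv/= s0/=.
  have /andP[_ h1] := tau_t j.
  have := HJ' (j + J)%N; rewrite /= (leq_trans J'j (leq_addr _ _)) => /(_ isT); lra.
(* Nothing is assumed about measurability of [Y] in time: the limit inherits it from the step
   functions. *)
have mG : measurable_fun `[0, t[ (fun s : measurableTypeR R => (along (generator b) s)%:E).
  exact: emeasurable_fun_cvg mf_ f_cvg.
have fM : {ae leb, forall s (j : nat), `[0, t[%classic s -> (`|f_ j s| <= (cst M%:E) s)%E}.
  apply: aeW => s j; rewrite /= in_itv/= => /andP[s0 st].
  rewrite /f_ patchE; case: ifP => _; last by rewrite abse0 lee_fin ltW.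
  rewrite lee_fin; apply: (HM (j + J)%N (leq_addl _ _)).
  have /andP[h1 _] := node_itv (j + J)%N s0.
  by rewrite mulr_ge0 ?(ltW (step_gt0 _))//= (le_trans h1)// ltW.
have iM : leb.-integrable `[0, t[ (cst M%:E).
  apply: integrable_cst_itv.
  rewrite lebesgue_measure_itv/= lte_fin.
  by case: ifP => _; rewrite ?ltry// -EFinB ltry.
have ae_cvg : {ae leb, forall s, `[0, t[%classic s ->
    f_ j s @[j --> \oo] --> (along (generator b) s)%:E}.
  by apply: aeW => s; exact: f_cvg.
have [ig _ fI] := @dominated_convergence _ _ R leb _
  (measurable_itv _) _ _ _ mf_ mG ae_cvg iM fM.
have EI : (\int[leb]_(s in `[0%R, t[) (along (generator b) s)%:E =
   \int[leb]_(s in `[0%R, t]) (along (generator b) s)%:E)%E.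
  exact: integral_itv_bndo_bndc.
rewrite -EI.
have mI : measurable (`[0, t[%classic : set (measurableTypeR R)) by exact: measurable_itv.
have := integrable_fin_num mI ig.
set I := integral _ _ _ in fI * => /fineK IE.
rewrite -IE -EFinD; congr (_%:E).
have fI' : (\sum_(i < k j) h (j + J)%N * gam j i) @[j --> \oo] --> fine I.
  apply: (@fine_cvg R nat \oo _ (fun j => (\sum_(i < k j) h (j + J)%N * gam j i)%:E)).
  move: fI; rewrite IE; apply: cvg_trans; apply: near_eq_cvg.
  by apply: nearW => j /=; rewrite If_.
have uI : u (step_path (j + J)%N t, tau j) @[j --> \oo] --> along u t.
  have := @u_cvg t; rewrite t0 tT => /(_ isT).
  by rewrite -(cvg_shiftn J).
apply/eqP; rewrite -subr_eq0 -normr_eq0 eq_le normr_ge0 andbT leNgt; apply/negP => c0.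
set c := `|_| in c0.
(* With this tolerance the total error over time [tau j <= t] is at most [c / 2], so the limit [c]
   would satisfy [c <= c / 2]. Using [t + 1] covers [t = 0]. *)
have e0 : 0 < c / (2 * (t + 1)) by rewrite divr_gt0// mulr_gt0//; lra.
have [J' _ HJ'] := step_telescope tT e0.
have : c <= c / 2; last by lra.
have cvgc : `|u (step_path (j + J)%N t, tau j) -
   (u (x0, 0) + \sum_(i < k j) h (j + J)%N * gam j i)| @[j --> \oo] --> c.
  by apply: cvg_norm; apply: cvgB => //; apply: cvgD => //; exact: cvg_cst.
apply: (closed_cvg (fun x => x <= c / 2)) cvgc; first exact: closed_le.
exists J' => // j /= J'j; rewrite opprD addrA.
have := HJ' (j + J)%N; rewrite /= (leq_trans J'j (leq_addr _ _)) => /(_ isT (k j)).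
have /andP[h1 _] := tau_t j; move=> /(_ h1) h2; apply: le_trans h2 _.
have t1 : t + 1 != 0 by lra.
rewrite (_ : c / 2 = c / (2 * (t + 1)) * (t + 1)); last by field.
by rewrite ler_pM2l// -/(tau j); lra.
Qed.

End EulerPaths.

(** * Measurability and image measures *)

Section KilledPushforward.
Local Open Scope ereal_scope.
Context d d' (X : measurableType d) (Y : measurableType d') (R : realType).
Variables (nu : {measure set X -> \bar R}) (D : set X) (phi : X -> Y).
Hypotheses (mD : measurable D) (mphi : measurable_fun setT phi).

(** The image under [phi] of [nu] restricted to [D]; mass outside [D], carried by paths at infinity,
    is lost. *)
Definition killed_pushforward (A : set Y) : \bar R := nu (D `&` phi @^-1` A).

Lemma measurable_killed_preimage A : measurable A -> measurable (D `&` phi @^-1` A).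
Proof. by move=> mA; apply: measurableI => //; rewrite -[_ @^-1` _]setTI; exact: mphi. Qed.

Let killed0 : killed_pushforward set0 = 0.
Proof. by rewrite /killed_pushforward preimage_set0 setI0 measure0. Qed.

Let killed_ge0 A : 0 <= killed_pushforward A.
Proof. exact: measure_ge0. Qed.

Let killed_sigma_additive : semi_sigma_additive killed_pushforward.
Proof.
move=> F mF tF mUF; rewrite /killed_pushforward preimage_bigcup setI_bigcupr.
apply: measure_semi_sigma_additive.
- by move=> n; exact: measurable_killed_preimage.
- apply: trivIset_setIl; apply/trivIsetP => /= i j _ _ ij; rewrite -preimage_setI.
  by move/trivIsetP : tF => /(_ _ _ _ _ ij) ->//; rewrite preimage_set0.
- by rewrite -setI_bigcupr -preimage_bigcup; exact: measurable_killed_preimage.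
Qed.

HB.instance Definition _ := isMeasure.Build _ _ _ killed_pushforward
  killed0 killed_ge0 killed_sigma_additive.

Lemma killed_pushforward_measure :
  exists m : {measure set Y -> \bar R}, m = killed_pushforward :> (set Y -> \bar R).
Proof. by exists (killed_pushforward : {measure set Y -> \bar R}). Qed.

Let ge0_integral_killed (B : set Y) (f : Y -> \bar R) : measurable B ->
  measurable_fun B f -> (forall y, B y -> 0 <= f y) ->
  \int[killed_pushforward]_(y in B) f y =
  \int[nu]_(x in D `&` phi @^-1` B) f (phi x).
Proof.
move=> mB mf f0; pose nuD := mrestr nu mD.
have mpB : measurable (phi @^-1` B) by rewrite -[_ @^-1` _]setTI; exact: mphi.
have mfphi : measurable_fun (phi @^-1` B) (f \o phi).
  apply: (measurable_comp mB _ mf); first by move=> _ [x Bx <-].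
  exact: measurable_funTS.
transitivity (\int[pushforward nuD phi]_(y in B) f y).
  apply: eq_measure_integral => A _ _.
  exact: (congr1 nu (setIC _ _)).
rewrite ge0_integral_pushforward//; last by move=> y; rewrite inE; exact: f0.
rewrite (@ge0_negligible_integral _ _ _ nuD _ (phi @^-1` B `\` D))//; last 3 first.
- exact: measurableD.
- by move=> x /= Bx; exact: f0.
- rewrite -(measure0 nu); apply: (congr1 nu).
  by apply/seteqP; split => // x [[]].
rewrite setDD setIC; apply: eq_measure_integral => A mA AD.
by apply: (congr1 nu); rewrite setIidl// => x /AD[].
Qed.

(** No integrability is required: the integral is the difference of those of the positive and
    negative parts, and the formula holds for each of them. *)
Lemma integral_killed (m : {measure set Y -> \bar R}) (B : set Y) (f : Y -> \bar R) :
  m = killed_pushforward :> (set Y -> \bar R) -> measurable B ->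
  measurable_fun B f ->
  \int[m]_(y in B) f y = \int[nu]_(x in D `&` phi @^-1` B) f (phi x).
Proof.
move=> mE mB mf; transitivity (\int[killed_pushforward]_(y in B) f y).
  by apply: eq_measure_integral => A _ _; rewrite mE.
rewrite [LHS]integralE [RHS]integralE; congr (_ - _).
  rewrite (ge0_integral_killed mB (measurable_funepos mf) (fun y _ => funepos_ge0 f y)).
  by apply: eq_integral => x _; rewrite (funepos_comp f phi).
rewrite (ge0_integral_killed mB (measurable_funeneg mf) (fun y _ => funeneg_ge0 f y)).
by apply: eq_integral => x _; rewrite (funeneg_comp f phi).
Qed.

Hypothesis nu_fin : fin_num_fun nu.

Let killed_fin : fin_num_fun killed_pushforward.
Proof. by move=> A mA; apply: nu_fin; exact: measurable_killed_preimage. Qed.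

HB.instance Definition _ :=
  @Measure_isFinite.Build _ _ _ killed_pushforward killed_fin.

Lemma killed_pushforward_finite_measure :
  exists m : {finite_measure set Y -> \bar R},
    m = killed_pushforward :> (set Y -> \bar R).
Proof. by exists (killed_pushforward : {finite_measure set Y -> \bar R}). Qed.

End KilledPushforward.

(** * Borel measurability of limits and of functions of space and time *)

Section BorelMeasurability.
Context {R : realType} {d : nat}.

Lemma open_borel (A : set 'rV[R]_d) : open A -> measurable (A : set (borelRV R d)).
Proof. exact: sub_sigma_algebra. Qed.

Lemma closed_borel (A : set 'rV[R]_d) : closed A -> measurable (A : set (borelRV R d)).
Proof.
by move=> cA; rewrite -[A]setCK; apply: measurableC; apply: open_borel; exact: closed_openC.
Qed.

Lemma continuous_borel (f : 'rV[R]_d -> 'rV[R]_d) : continuous f ->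
  measurable_fun setT (f : borelRV R d -> borelRV R d).
Proof.
move=> cf; apply: (@measurability _ _ (borelRV R d) (borelRV R d) setT f
  (@open 'rV[R]_d) erefl).
move=> _ [U oU <-]; rewrite setTI; apply: open_borel.
by apply: open_comp => // x _; exact: cf.
Qed.

Lemma continuous_borel_real (f : 'rV[R]_d -> R) : continuous f ->
  measurable_fun setT (f : borelRV R d -> R).
Proof.
move=> cf; apply: (measurability _ (RGenOInfty.measurableE R)).
move=> _ [_ [a ->] <-]; rewrite setTI; apply: open_borel.
by apply: open_comp => [x _|]; [exact: cf|rewrite set_itvE; exact: open_gt].
Qed.

Context e (X : measurableType e).

(** An open [U] is the union of the closed sets [C n] of points at distance at least [1 / (n + 1)]
    from its complement. The limit lies in [U] exactly when, for some [n], the sequence is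
    eventually in [C n], and this is a countable condition. *)
Lemma measurable_fun_borel_cvg (D : set X) (f : nat -> X -> borelRV R d)
    (g : X -> borelRV R d) : measurable D ->
  (forall j, measurable_fun setT (f j)) ->
  (forall x, D x -> (f j x : 'rV[R]_d) @[j --> \oo] --> (g x : 'rV[R]_d)) ->
  measurable_fun D g.
Proof.
move=> mD mf fg; apply: (@measurability _ _ X (borelRV R d) D g
  (@open 'rV[R]_d) erefl).
move=> _ [U oU <-].
pose C n : set 'rV[R]_d := ~` \bigcup_(z in ~` U) ball z n.+1%:R^-1.
have cC n : closed (C n).
  by apply: open_closedC; apply: bigcup_open => z _; exact: ball_open.
have -> : D `&` g @^-1` U =
    D `&` \bigcup_n \bigcup_J \bigcap_(j in [set j | (J <= j)%N]) (f j @^-1` C n).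
  apply/seteqP; split => x [Dx]; last first.
    move=> [n _ [J _ H]]; split => //=; apply: contrapT => nU.
    have /cvgrPdist_lt := fg x Dx.
    move=> /(_ (n.+1%:R^-1) ltac:(by rewrite invr_gt0)) [K _ HK].
    have := H (maxn J K) (leq_maxl _ _); apply.
    by exists (g x) => //; rewrite -ball_normE; exact: (HK _ (leq_maxr _ _)).
  move=> /= Ux; split => //.
  have /nbhs_ballP[r /= r0 rU] : nbhs (g x : 'rV[R]_d) U by exact: open_nbhs_nbhs.
  pose n := Num.truncn (2 / r).
  have nr : n.+1%:R^-1 < r / 2.
    by rewrite invf_plt ?posrE ?divr_gt0// invf_div; exact: truncnS_gt.
  have /cvgrPdist_lt/(_ (r / 2) ltac:(by rewrite divr_gt0)) [K _ HK] := fg x Dx.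
  exists n => //; exists K => // j /= Kj [z nUz]; rewrite -ball_normE /= => zf.
  apply: nUz; apply: rU; rewrite -ball_normE /=.
  rewrite -(subrK (f j x : 'rV[R]_d) (g x)) -addrA.
  apply: le_lt_trans (ler_normD _ _) _; have := HK j Kj; rewrite /= => h1.
  by have h3 := lt_trans zf nr; rewrite [`|_ - z|]distrC; lra.
apply: measurableI => //; apply: bigcupT_measurable => n.
apply: bigcupT_measurable => J; apply: bigcap_measurableType => j _.
by have := mf j measurableT _ (closed_borel (cC n)); rewrite setTI.
Qed.

(* [F] is the limit of its versions frozen in time on the grid of step
   [1 / (n + 1)], rounding the time down so as to stay in [A]. *)
Lemma measurable_caratheodory (A : set R) (F : 'rV[R]_d * R -> R)
    (y : X -> borelRV R d) (s : X -> measurableTypeR R) :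
  (forall t, A t -> 0 <= t) -> (forall a t, A t -> 0 <= a <= t -> A a) ->
  {within setT `*` A, continuous F} ->
  measurable_fun setT y -> measurable_fun setT s ->
  measurable_fun (s @^-1` A) (fun x => F (y x, s x)).
Proof.
move=> A0 Adown cF my ms.
pose F' a (z : 'rV[R]_d) := if `[< A a >] then F (z, a) else 0.
have cF' a : continuous (F' a).
  rewrite /F'; case: (asboolP (A a)) => [Aa|_]; last exact: cst_continuous.
  move=> z; apply/(@cvgrPdist_lt R _ _ _ (nbhs_filter z)) => r r0.
  have [rho rho0 H] := (within_continuousE _ _).1 cF (z, a) (conj I Aa) r r0.
  apply/nbhs_ballP; exists rho => //= w; rewrite -ball_normE /= => zw.
  by apply: H => //; apply: pair_norm_lt => //; rewrite subrr normr0.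
pose h (n : nat) : R := n.+1%:R^-1.
have h0 n : 0 < h n by rewrite invr_gt0.
pose f n x := F' ((Num.truncn (s x / h n))%:R * h n) (y x).
have mf n : measurable_fun setT (f n).
  apply: (@measurable_switch _ _ X _ (fun x => Num.truncn (s x / h n))
    (fun k x => F' (k%:R * h n) (y x))) => k.
    rewrite -[_ @^-1` _]setTI.
    exact: (ms measurableT _ (measurable_truncn_div k (h0 n))).
  apply: (measurableT_comp (continuous_borel_real (cF' _)) my).
apply: (@measurable_fun_cvg _ _ _ _ f) => [n|x /= As]; first exact: measurable_funTS.
have s0 := A0 _ As.
have hn n : 0 <= (Num.truncn (s x / h n))%:R * h n <= s x.
  have := @truncn_itv R (s x / h n) (divr_ge0 s0 (ltW (h0 n))).
  by rewrite ler_pdivlMr// => /andP[-> _]; rewrite mulr_ge0 ?(ltW (h0 n)).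
have fE n : f n x = F (y x, (Num.truncn (s x / h n))%:R * h n).
  by rewrite /f /F' asboolT//; exact: Adown (hn n).
under eq_fun do rewrite fE.
apply: (within_cvg_seq cF); first by split.
  by apply: nearW => n; split => //=; exact: Adown (hn n).
apply: cvg_pair_seq; first exact: cvg_cst.
apply/cvgrPdist_lt => r r0.
have [K _ HK] := @near_infty_natSinv_lt R (PosNum r0).
exists K => // n /= Kn; have := HK n Kn; rewrite /= -/(h n) => hr.
have := @truncn_itv R (s x / h n) (divr_ge0 s0 (ltW (h0 n))).
rewrite ler_pdivlMr// ltr_pdivrMr// -natr1 mulrDl mul1r => /andP[h1 h2].
rewrite ger0_norm ?subr_ge0//; lra.
Qed.

End BorelMeasurability.

(** * The limit flow, measurable jointly in time and starting point *)

Section LimitFlow.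
Context {R : realType} {d : nat}.
Variables (T : R) (b : 'rV[R]_d * R -> 'rV[R]_d).
Variables (bk : nat -> 'rV[R]_d * R -> 'rV[R]_d) (Vk : nat -> 'rV[R]_d -> R).
Variables (C1 C2 C3 : R).
Hypotheses (T_gt0 : 0 < T) (b_cont : {within setT `*` `[0, T], continuous b}).
Hypothesis bk_cont : forall k, continuous (bk k).
Hypothesis Vk_C1 : forall k, C1_space (Vk k).
Hypothesis Vk_gt0 : forall k x, 0 < Vk k x.
Hypotheses (C1_ge0 : 0 <= C1) (C2_ge0 : 0 <= C2).
Hypothesis Vk_le : forall k m, (k <= m)%N -> forall x, Vk k x <= C1 * Vk m x + C2.
Hypothesis Vk_lyapunov : forall k x t, 0 <= t <= T ->
  dotr (bk k (x, t)) (grad (Vk k) x) <= C3 * Vk k x.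
Hypothesis bk_growth : forall k, exists G, forall x t, 0 <= t <= T ->
  `|bk k (x, t)| <= G * (1 + `|x|).
Hypothesis bk_cvg : forall N e, 0 < e -> \forall k \near \oo,
  forall x t, `|x| <= N -> 0 <= t <= T -> `|b (x, t) - bk k (x, t)| < e.

Local Notation spacetime := (measurableTypeR R * borelRV R d)%type.

(** The set [D] records when the path is at a finite point. The threshold [m] in the Lyapunov clause
    may depend on [t], [x] and [k], but [al] and [be] may not; this is what a lower limit over [l]
    can use. *)
Lemma limit_flow : exists (D : set spacetime) (Y : spacetime -> borelRV R d),
  [/\ measurable D, measurable_fun setT Y,
      (forall t x, D (t, x) -> 0 <= t <= T),
      (exists al be : R, [/\ 0 <= al, 0 <= be & forall t x, D (t, x) -> forall k,
        exists m, forall l, (m <= l)%N -> Vk k (Y (t, x)) <= al * Vk l x + be]) &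
      forall u ut ux r, C1_slab T u ut ux ->
        (forall x t, 0 <= t < T -> r < `|x| -> u (x, t) = 0) ->
        forall (x : 'rV[R]_d) t, 0 <= t < T ->
        ((along [set s | D (s, x)] (fun s => Y (s, x)) u t)%:E =
         (u (x, 0%R))%:E + \int[lebesgue_measure]_(s in `[0%R, t])
           (along [set s | D (s, x)] (fun s => Y (s, x)) (generator ut ux b) s)%:E)%E].
Proof.
pose K := expR ((`|C3| + 1) * T).
have : forall m : nat, exists n : nat, [/\ (0 < n)%N, T / n%:R <= m.+1%:R^-1 &
    forall x : 'rV[R]_d, `|x| <= m%:R ->
    (forall i, (i < n)%N ->
       `|euler (bk m) (T / n%:R) i.+1 x - euler (bk m) (T / n%:R) i x| <= m.+1%:R^-1) /\
    (forall i, (i <= n)%N ->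
       Vk m (euler (bk m) (T / n%:R) i x) + 1 <= K * (Vk m x + 1))].
  move=> m; have [G HG] := bk_growth m.
  have m0 : 0 < m.+1%:R^-1 :> R by rewrite invr_gt0.
  have [n n0 [h1 h2]] := euler_good_step T_gt0 (bk_cont (k := m)) (Vk_gt0 m)
    (Vk_C1 m) (Vk_lyapunov m) HG m%:R m0.
  by exists n.
move=> /choice[n Hn].
have n0 m : (0 < n m)%N by have [] := Hn m.
pose h m : R := T / (n m)%:R.
have h0 m : 0 < h m by rewrite divr_gt0// ltr0n.
pose Z m (w : spacetime) : borelRV R d :=
  euler (bk m) (h m) (Num.truncn (w.1 / h m)) w.2.
have mZ m : measurable_fun setT (Z m).
  apply: (@measurable_switch _ _ spacetime (borelRV R d)
    (fun w => Num.truncn (w.1 / h m)) (fun k w => euler (bk m) (h m) k w.2)) => k.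
    rewrite -[_ @^-1` _]setTI.
    exact: (@measurable_fst _ _ (measurableTypeR R) (borelRV R d)
      measurableT _ (measurable_truncn_div k (h0 m))).
  have mek := continuous_borel (@euler_continuous _ _ _ (bk_cont (k := m)) (h m) k).
  exact: (measurableT_comp mek (@measurable_snd _ _ (measurableTypeR R) (borelRV R d))).
(* The code [a] runs over quadruples of a rational time, a radius, a probe type and a rational
   threshold; numbers that code nothing get the trivial condition. *)
pose P a m : set (borelRV R d) :=
  if (unpickle a : option (rat * nat * option 'I_d * rat)) is Some (q, N, o, c)
  then [set x | probe N o (Z m (ratr q, x)) < ratr c] else setT.
have mP a m : measurable (P a m).
  rewrite /P; case: (unpickle a) => [[[[q N] o] c]|]; last exact: measurableT.
  apply: open_borel.
  pose ez (x : 'rV[R]_d) := euler (bk m) (h m) (Num.truncn (ratr q / h m)) x.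
  apply: (@open_comp 'rV[R]_d R (probe N o \o ez) [set y | y < ratr c]).
    move=> x _; apply: (@continuous_comp 'rV[R]_d 'rV[R]_d R ez (probe N o)).
      exact: euler_continuous.
    exact: probe_continuous.
  exact: open_lt.
have [s [ms sj sP]] := selection_exists mP.
pose Zs j (w : spacetime) : borelRV R d := Z (s j w.2) w.
have mZs j : measurable_fun setT (Zs j).
  apply: (@measurable_switch _ _ spacetime (borelRV R d) (fun w => s j w.2) Z) => // k.
  rewrite -[_ @^-1` _]setTI.
  exact: (@measurable_snd _ _ (measurableTypeR R) (borelRV R d)
    measurableT _ (ms j k)).
(* Convergence is expressed as eventual boundedness, which is equivalent by the dichotomy and
   visibly a countable combination of measurable sets. *)
pose D : set spacetime := [set w | 0 <= w.1 <= T] `&`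
  \bigcup_(N : nat) \bigcup_J \bigcap_(j in [set j | (J <= j)%N])
    [set w | `|Zs j w : 'rV[R]_d| <= N%:R].
pose Y (w : spacetime) : borelRV R d :=
  if `[< D w >] then lim ((Zs j w : 'rV[R]_d) @[j --> \oo]) else (0 : 'rV[R]_d).
have mD : measurable D.
  apply: measurableI.
    have -> : [set w : spacetime | 0 <= w.1 <= T] = fst @^-1` `[0, T]%classic.
      by apply/seteqP; split => w /=; rewrite in_itv.
    rewrite -[_ @^-1` _]setTI.
    exact: (@measurable_fst _ _ (measurableTypeR R) (borelRV R d)
      measurableT _ (measurable_itv _)).
  apply: bigcupT_measurable => N; apply: bigcupT_measurable => J.
  apply: bigcap_measurableType => j _.
  have cN : measurable ([set x : 'rV[R]_d | `|x| <= N%:R] : set (borelRV R d)).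
    by apply: closed_borel; apply: compact_closed => //; exact: compact_norm_le.
  by have := mZs j measurableT _ cN; rewrite setTI.
have inv_cvg0 (e : R) : 0 < e -> \forall j \near \oo, j.+1%:R^-1 < e.
  by move=> e0; exact: (@near_infty_natSinv_lt R (PosNum e0)).
have sinv x j : (s j x).+1%:R^-1 <= j.+1%:R^-1 :> R.
  by rewrite lef_pV2 ?posrE// ler_nat ltnS.
have Hh x e : 0 < e -> \forall j \near \oo, T / (n (s j x))%:R < e.
  move=> e0; apply: filterS (inv_cvg0 e e0) => j; apply: le_lt_trans.
  by have [_ + _] := Hn (s j x) => /le_trans; apply.
have Hbb x N e : 0 < e -> \forall j \near \oo, forall y t, `|y| <= N -> 0 <= t <= T ->
    `|b (y, t) - bk (s j x) (y, t)| < e.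
  move=> /(bk_cvg N)[J _ HJ]; exists J => // j /= Jj.
  by apply: HJ => /=; exact: leq_trans Jj (sj j x).
(* The scheme of index [m] is controlled only from starting points of norm at most [m]; as
   [s j x >= j], every [x] eventually qualifies. *)
have norm_s x : \forall j \near \oo, `|x : 'rV[R]_d| <= (s j x)%:R.
  exists (Num.truncn `|x : 'rV[R]_d|).+1 => // j /= Jj.
  apply: le_trans (ltW (truncnS_gt _)) _.
  by rewrite ler_nat (leq_trans Jj).
pose p x j i : 'rV[R]_d := euler (bk (s j x)) (h (s j x)) i x.
have Hp x : \forall j \near \oo, forall i, (i < n (s j x))%N ->
    `|p x j i.+1 - p x j i| <= 1.
  apply: filterS (norm_s x) => j xs i ni.
  have [_ _ /(_ x xs)[+ _]] := Hn (s j x) => /(_ i ni) /le_trans; apply.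
  by rewrite invf_le1// ler1n.
have Hrat x (q : rat) : 0 <= (ratr q : R) <= T -> forall N o,
    cvgn (fun j => probe N o (Zs j (ratr q, x))).
  move=> _ N o; apply: (@eventually_separated_cvg _ _ N%:R) => [j|c].
    exact: probe_bound.
  have := sP (pickle (q, N, o, c)) x; rewrite /P pickleK.
  by case=> H; [left|right]; exists (pickle (q, N, o, c)).+1 => // j /= /H.
have lim_path x t : 0 <= t <= T ->
    (D (t, x) /\ (Zs j (t, x) : 'rV[R]_d) @[j --> \oo] --> (Y (t, x) : 'rV[R]_d)) \/
    (~ D (t, x) /\ forall N : nat, \forall j \near \oo, N%:R < `|Zs j (t, x) : 'rV[R]_d|).
  move=> tT; have [[y Zy]|Zoo] := path_dichotomy (bb := fun j => bk (s j x)) T_gt0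
    (fun j => n0 (s j x)) (Hh x)
    b_cont (Hbb x) (p := p x) (fun j i => erefl) (Hp x) (Hrat x) tT.
    left; have Dtx : D (t, x).
      split => //; have /cvgrPdist_lt/(_ 1 ltr01)[J _ HJ] := Zy.
      exists (Num.truncn (`|y| + 1)).+1 => //; exists J => // j /= Jj.
      apply: le_trans (ltW (truncnS_gt _)).
      have := HJ j Jj; rewrite /= => h1.
      rewrite -[Zs j _ : 'rV[R]_d](subKr y); apply: le_trans (ler_normB _ _) _.
      by rewrite lerD2l ltW.
    split => //; rewrite /Y asboolT//.
    by rewrite (cvg_lim (@norm_hausdorff _ _) Zy).
  right; split => // -[_ [N _ [J _ HJ]]].
  have [J' _ HJ'] := Zoo N.
  have := HJ (maxn J J') (leq_maxl _ _); have := HJ' (maxn J J') (leq_maxr _ _).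
  by rewrite /= => /lt_le_trans h1 /h1; rewrite ltxx.
exists D, Y; split => //.
- rewrite -(setUv D); apply/measurable_funU => //; first exact: measurableC.
  split.
    apply: (measurable_fun_borel_cvg mD mZs) => -[t x] Dw.
    by have [[]|[]//] := lim_path x t Dw.1.
  apply: (@eq_measurable_fun _ _ spacetime (borelRV R d) _ (cst (0 : 'rV[R]_d))).
    by move=> w; rewrite inE /= => nDw; rewrite /Y asboolF.
  exact: measurable_cst.
- by move=> t x [].
- have K0 : 0 <= K := expR_ge0 _.
  (* Hypothesis (i) passes from [Vk k] to the index [s j x] at the polygon, the Euler estimate goes
     back to [x] at cost [K], and (i) at [x] passes to [l]. The last 1 pays for replacing the limit
     point by a polygon point. *)
  exists (C1 * K * C1), (C1 * K * (C2 + 1) + C2 + 1); split.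
  + by rewrite !mulr_ge0.
  + by rewrite !addr_ge0 ?mulr_ge0 ?addr_ge0.
  move=> t x Dtx k; have tT : 0 <= t <= T by have [] := Dtx.
  have [[_ ZY]|[]//] := lim_path x t tT.
  have VZ : Vk k (Zs j (t, x)) @[j --> \oo] --> Vk k (Y (t, x)).
    apply: (@within_cvg_seq _ _ _ setT (Vk k : 'rV[R]_d -> R)) ZY => //; last exact: nearW.
    by apply: continuous_subspaceT; exact: C1_space_continuous.
  have V1 : Vk k (Y (t, x)) - 1 < Vk k (Y (t, x)) by rewrite ltrBlDr ltrDl.
  have [J1 _ HJ1] := cvgr_gt _ VZ _ V1.
  have [J2 _ HJ2] := norm_s x.
  pose j := maxn (maxn J1 J2) k.
  have j1 : (J1 <= j)%N by rewrite /j !leq_max leqnn.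
  have j2 : (J2 <= j)%N by rewrite /j !leq_max leqnn orbT.
  have jk : (k <= j)%N by exact: leq_maxr.
  have h1 := HJ1 j j1; have h2 := HJ2 j j2.
  exists (s j x) => l sl.
  have h3 : Vk (s j x) (Zs j (t, x)) + 1 <= K * (Vk (s j x) x + 1).
    have [_ _ /(_ x h2)[_]] := Hn (s j x); apply.
    exact: (node_le T_gt0 (fun j => n0 (s j x)) j tT).
  have h4 : Vk k (Zs j (t, x)) <= C1 * Vk (s j x) (Zs j (t, x)) + C2.
    by apply: Vk_le; exact: leq_trans jk (sj j x).
  have h5 : Vk (s j x) x <= C1 * Vk l x + C2 by exact: Vk_le.
  have h6 : C1 * Vk (s j x) (Zs j (t, x)) <= C1 * (K * (C1 * Vk l x + C2 + 1)).
    rewrite ler_wpM2l//; apply: (@le_trans _ _ (K * (Vk (s j x) x + 1))).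
      by apply: le_trans h3; rewrite lerDl.
    by rewrite ler_wpM2l// lerD2r.
  rewrite (_ : _ + _ = C1 * (K * (C1 * Vk l x + C2 + 1)) + C2 + 1); last by ring.
  by move: h1; rewrite /=; lra.
- move=> u ut ux r su u0 x t tT.
  apply: (path_identity (bb := fun j => bk (s j x)) T_gt0
    (fun j => n0 (s j x)) (Hh x)
    b_cont (Hbb x) (p := p x) (fun j i => erefl) (Hp x) (fun j => erefl) _ su u0 tT).
  by move=> t' t'T; exact: lim_path.
Qed.

End LimitFlow.

Section IntegrableMarginal.
Local Open Scope ereal_scope.
Context d1 d2 (T1 : measurableType d1) (T2 : measurableType d2) (R : realType).
Variables (m1 : {sigma_finite_measure set T1 -> \bar R})
  (m2 : {sigma_finite_measure set T2 -> \bar R}) (f : T1 * T2 -> \bar R).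

Lemma integrable_marginal2 : (m1 \x m2).-integrable setT f ->
  m2.-integrable setT (fun y => \int[m1]_x f (x, y)).
Proof.
move=> imf; have mf := measurable_int _ imf.
apply/integrableP; split; first exact: (measurable_fubini_G imf).
apply: le_lt_trans ((integrable21ltyP _ _ mf).1 imf).
apply: ge0_le_integral => //.
- by apply: measurableT_comp => //; exact: (measurable_fubini_G imf).
- apply: (measurable_fun_fubini_tonelli_G (abse \o f)) => //=.
  exact: measurableT_comp.
- by move=> y _; apply: le_abse_integral => //; exact: measurableT_comp.
Qed.

End IntegrableMarginal.

(** * The solution of the Cauchy problem *)

Section Transport.
Context {R : realType} {d : nat}.
Local Notation spacetime := (measurableTypeR R * borelRV R d)%type.
Local Notation leb := (@lebesgue_measure R).
Variables (T : R) (nu : {finite_measure set (borelRV R d) -> \bar R}).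
Variables (D : set spacetime) (Y : spacetime -> borelRV R d).
Hypotheses (T_gt0 : 0 < T) (mD : measurable D) (mY : measurable_fun setT Y).
Hypothesis D_T : forall t x, D (t, x) -> 0 <= t <= T.

Local Open Scope ereal_scope.
Local Notation pm := (leb \x nu).

Let slice t : set (borelRV R d) := [set x | D (t, x)].
Let Yt t x := Y (t, x).

Let mslice t : measurable (slice t).
Proof.
rewrite -[slice t]setTI.
exact: (@pair1_measurable _ _ (measurableTypeR R) (borelRV R d) t measurableT _ mD).
Qed.

Let mYt t : measurable_fun setT (Yt t).
Proof. exact: (measurableT_comp mY (pair1_measurable t)). Qed.

(** The flow is parametrized with time first, the space-time measure of the problem with space
    first; [psi] carries one to the other. *)
Let psi (w : spacetime) : borelRV R d * measurableTypeR R := (Y w, w.1).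

Let mpsi : measurable_fun setT psi.
Proof. by apply: measurable_fun_pair => //; exact: measurable_fst. Qed.

Lemma product_restricted_lty (E : set spacetime) : measurable E -> E `<=` D ->
  pm E < +oo.
Proof.
move=> mE ED; apply: (@le_lt_trans _ _ (pm (`[0%R, T]%classic `*` setT))).
  apply: le_measure; rewrite ?inE//; first exact: measurableX.
  by move=> [t x] /ED/D_T tT; split => //=; rewrite in_itv.
rewrite product_measure1E//.
apply: lte_mul_pinfty => //.
  by rewrite ge0_fin_numE//; exact: segment_measure.
by rewrite -ge0_fin_numE// fin_num_measure.
Qed.

(** Extension by zero puts the function on the full product, where Fubini applies, although Lebesgue
    measure on the time axis is infinite. *)
Lemma integrable_product (E : set spacetime) (g : spacetime -> R) (M : R) :
  measurable E -> E `<=` D -> measurable_fun E g ->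
  (forall w, E w -> (`|g w| <= M)%R) ->
  pm.-integrable setT ((EFin \o g) \_ E).
Proof.
move=> mE ED mg gM; apply/(integrable_restrict _ mE); rewrite ?setTI//.
apply: measurable_bounded_integrable => //; first exact: product_restricted_lty.
exists M; split; first exact: num_real.
by move=> N MN w Ew; apply: (le_trans (gM w Ew)); exact: ltW.
Qed.

Variable mu : R -> {finite_measure set (borelRV R d) -> \bar R}.
Hypothesis muE : forall t,
  mu t = killed_pushforward nu (slice t) (Yt t) :> (set (borelRV R d) -> \bar R).

Lemma integral_mu t (B : set (borelRV R d)) f : measurable B -> measurable_fun B f ->
  \int[mu t]_(y in B) f y = \int[nu]_x ((f \o Yt t) \_ (slice t `&` Yt t @^-1` B)) x.
Proof.
by move=> mB mf; rewrite (integral_killed (mslice t) (mYt t) (muE t))// integral_mkcond.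
Qed.

Lemma mu_le t (B : set (borelRV R d)) : measurable B -> mu t B <= nu setT.
Proof.
move=> mB; rewrite muE; apply: le_measure; rewrite ?inE//.
exact: (measurable_killed_preimage (mslice t) (mYt t)).
Qed.

Lemma measurable_mu (B : set (borelRV R d)) : measurable B ->
  measurable_fun setT (fun t : measurableTypeR R => mu t B).
Proof.
move=> mB; have mA := measurable_killed_preimage mD mY mB.
rewrite (_ : (fun _ => _) = nu \o xsection (D `&` Y @^-1` B)).
  exact: measurable_fun_xsection.
apply/funext => t /=; rewrite muE; apply: (congr1 nu).
by apply/seteqP; split => x; rewrite /xsection /= inE.
Qed.

Lemma admissible_mu : admissible_family T mu.
Proof.
split=> [B mB _|K cK]; first exact: (measurable_funTS (measurable_mu mB)).
have mK : measurable (K : set (borelRV R d)).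
  by apply: closed_borel; exact: compact_closed.
apply: (le_integrable _ _ _
  (integrable_cst_itv (fine (nu setT)) (segment_measure 0 T))) => //.
  exact: (measurable_funTS (measurable_mu mK)).
move=> t _ /=; rewrite gee0_abs// (le_trans (mu_le t mK))//.
by rewrite -[leLHS]fineK ?fin_num_measure// lee_fin ler_norm.
Qed.

Section SlabFunctions.
Variables (A : set R) (F : 'rV[R]_d * R -> R).
Hypotheses (A_ge0 : forall t, A t -> (0 <= t)%R).
Hypothesis A_down : forall a t, A t -> (0 <= a <= t)%R -> A a.
Hypothesis F_cont : {within setT `*` A, continuous F}.

(** The time set [A] is left general: it is [[0, T]] for the field and [[0, T[] for test functions
    and their derivatives. *)
Lemma measurable_slab :
  measurable_fun (setT `*` A : set (borelRV R d * measurableTypeR R)) F.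
Proof.
have := @measurable_caratheodory R d _ (borelRV R d * measurableTypeR R)%type A F
  fst snd A_ge0 A_down F_cont measurable_fst measurable_snd.
rewrite (_ : snd @^-1` A = setT `*` A); last by apply/seteqP; split => z //= -[].
by apply: eq_measurable_fun => -[].
Qed.

Lemma measurable_time_section t : A t ->
  measurable_fun setT (fun x : borelRV R d => F (x, t)).
Proof.
move=> At; have := @measurable_caratheodory R d _ (borelRV R d) A F
  id (cst t) A_ge0 A_down F_cont (@measurable_id _ _ _) (@measurable_cst _ _ _ _ _ _).
by rewrite (_ : _ @^-1` A = setT)//; apply/seteqP; split.
Qed.

Lemma measurable_flow : measurable_fun (fst @^-1` A) (fun w : spacetime => F (Y w, w.1)).
Proof.
exact: (@measurable_caratheodory R d _ spacetime A F Y fst A_ge0 A_down F_cont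
  mY measurable_fst).
Qed.

End SlabFunctions.

Variable m : {measure set (borelRV R d * measurableTypeR R) -> \bar R}.
Hypothesis mE : m = killed_pushforward pm D psi :> (set _ -> \bar R).

Lemma given_by_mu : given_by_family T mu m.
Proof.
split.
(* The product measure integrates the [nu]-measures of sections; at times outside [[0, T]] the
   section of [D] is empty. *)
- move=> A mA; rewrite mE /killed_pushforward /product_measure1 [RHS]integral_mkcond.
  apply: eq_integral => t _; rewrite patchE; case: ifPn => tT.
    rewrite muE; apply: (congr1 nu).
    by apply/seteqP; split => x; rewrite /xsection /ysection/= !inE.
  transitivity (nu set0); last exact: measure0.
  apply: (congr1 nu).
  apply/seteqP; split => // x; rewrite /xsection /= inE => -[/D_T tT' _].
  by move: tT; rewrite notin_setE /= in_itv.
- move=> u [us [K [cK KT uK]]].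
  have uc : continuous u by have [] := us 0%N.
  have [M M0 uM] : exists2 M : R, (0 < M)%R & forall z, (`|u z| <= M)%R.
    have [M M0 HM] := compact_bound cK (continuous_subspaceT uc).
    exists M => // z; have [/HM//|/uK ->] := pselect (K z).
    by rewrite normr0 ltW.
  pose A : set R := `[0%R, T]%classic.
  have A0 t : A t -> (0 <= t)%R by rewrite /A /= in_itv/= => /andP[].
  have Ad a t : A t -> (0 <= a <= t)%R -> A a.
    rewrite /A /= !in_itv/= => /andP[_ tT] /andP[-> /le_trans]; exact.
  have uA : {within setT `*` A, continuous u} by exact: continuous_subspaceT.
  have mslab : measurable (setT `*` A : set (borelRV R d * measurableTypeR R)).
    by apply: measurableX => //; exact: measurable_itv.
  have DA : D `&` psi @^-1` (setT `*` A) = D.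
    apply/seteqP; split => [w []//|[t x] Dtx]; split => //=; split => //.
    by rewrite /A /= in_itv/=; exact: D_T Dtx.
  have DsA : D `<=` fst @^-1` A by move=> [t x] /D_T tT; rewrite /A /= in_itv.
  have mu_ : measurable_fun D (fun w : spacetime => u (Y w, w.1)).
    apply: measurable_funS DsA (measurable_flow A0 Ad uA).
    rewrite -[_ @^-1` _]setTI.
    exact: (@measurable_fst _ _ (measurableTypeR R) (borelRV R d)
      measurableT _ (measurable_itv _)).
  rewrite (integral_killed mD mpsi mE)//; last first.
    by apply/measurable_EFinP; exact: measurable_slab.
  rewrite DA [LHS]integral_mkcond.
  have iu := integrable_product mD (@subset_refl _ D) mu_ (fun w _ => uM _).
  rewrite -(integral12_prod_meas1 iu) [RHS]integral_mkcond.
  apply: eq_integral => t _; rewrite patchE; case: ifPn => tT.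
    rewrite integral_mu//; last first.
      apply/measurable_EFinP; apply: (measurable_time_section A0 Ad uA).
      by move: tT; rewrite inE.
    by apply: eq_integral => x _; rewrite !patchE; congr (if _ then _ else _);
      rewrite preimage_setT setIT; apply/idP/idP; rewrite !inE.
  apply: integral0_eq => x _; rewrite patchE; case: ifPn => //.
  rewrite inE => /D_T tT'; move: tT; rewrite notin_setE /= in_itv/=.
  by rewrite tT'.
Qed.

Lemma integrable_slab (b : 'rV[R]_d * R -> R) (B : set (borelRV R d)) M :
  {within setT `*` `[0%R, T], continuous b} -> measurable B ->
  (forall x t, B x -> (0 <= t <= T)%R -> (`|b (x, t)| <= M)%R) ->
  m.-integrable (B `*` `[0%R, T]) (EFin \o b).
Proof.
move=> cb mB bM.
have mBT : measurable (B `*` `[0%R, T] : set (borelRV R d * measurableTypeR R)).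
  by apply: measurableX => //; exact: measurable_itv.
apply: measurable_bounded_integrable => //.
- rewrite mE; apply: product_restricted_lty; last by move=> w [].
  exact: (measurable_killed_preimage mD mpsi).
- apply: (@measurable_funS _ _ _ _ (setT `*` `[0%R, T]%classic)) => //.
  + by apply: measurableX => //; exact: measurable_itv.
  + by move=> z [].
  + apply: measurable_slab cb => [t|a t] /=; rewrite !in_itv/=; first by case/andP.
    by move=> /andP[_ tT] /andP[-> /le_trans]; exact.
- exists M; split; first exact: num_real.
  move=> N MN [x t] [/= Bx]; rewrite in_itv/= => tT.
  by apply: (le_trans (bM x t Bx tT)); exact: ltW.
Qed.

Section Cauchy.
Variables (b : 'rV[R]_d * R -> 'rV[R]_d).
Variables (u ut : 'rV[R]_d * R -> R) (ux : 'rV[R]_d * R -> 'rV[R]_d) (r : R).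
Hypothesis b_cont : {within setT `*` `[0%R, T], continuous b}.
Hypothesis su : C1_slab T u ut ux.
Hypothesis u0 : forall x t, (0 <= t < T)%R -> (r < `|x|)%R -> u (x, t) = 0%R.

Let A : set R := `[0%R, T[%classic.

Let A_ge0 t : A t -> (0 <= t)%R.
Proof. by rewrite /A /= in_itv/= => /andP[]. Qed.

Let A_down a t : A t -> (0 <= a <= t)%R -> A a.
Proof.
by rewrite /A /= !in_itv/= => /andP[_ tT] /andP[-> at_]; exact: le_lt_trans at_ tT.
Qed.

Lemma generator_continuous : {within setT `*` A, continuous (generator ut ux b)}.
Proof.
move=> z; apply: cvgD; first exact: (slab_cont_t su).
apply: cvg_dotr; last exact: (slab_cont_x su).
apply: (continuous_subspaceW _ b_cont) => -[x t] [_]; rewrite /A /= !in_itv/=.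
by move=> /andP[t0 tT]; split => //=; rewrite ?in_itv/= t0 ltW.
Qed.

Lemma slab_fun_bound (F : 'rV[R]_d * R -> R) t : (t < T)%R ->
  {within setT `*` A, continuous F} ->
  (forall x s, (0 <= s < T)%R -> (r < `|x|)%R -> F (x, s) = 0%R) ->
  exists M, forall x s, (0 <= s <= t)%R -> (`|F (x, s)| <= M)%R.
Proof.
move=> tT cF F0.
have [M M0 HM] := compact_bound (@compact_slab R d r 0%R t)
  (continuous_subspaceW (slab_sub (r := r) tT) cF).
exists M => x s /andP[s0 st]; have [xr|rx] := leP `|x|%R r.
  by apply: HM; split => //=; rewrite in_itv/= s0.
by rewrite F0 ?normr0 ?(ltW M0)// s0 (le_lt_trans st).
Qed.

(** The pathwise identity is integrated against [nu], and Fubini exchanges [nu] with the time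
    integral; bounded integrands on a set of finite product measure justify both operations. *)
Lemma cauchy_mu t : (0 <= t < T)%R ->
  (forall x, (along [set s | D (s, x)] (fun s => Y (s, x)) u t)%:E =
    (u (x, 0%R))%:E + \int[leb]_(s in `[0%R, t])
      (along [set s | D (s, x)] (fun s => Y (s, x)) (generator ut ux b) s)%:E) ->
  \int[mu t]_x (u (x, t))%:E =
  \int[nu]_x (u (x, 0%R))%:E +
  \int[leb]_(s in `[0%R, t]) \int[mu s]_x (generator ut ux b (x, s))%:E.
Proof.
move=> /andP[t0 tT] Hpath.
have At : A t by rewrite /A /= in_itv/= t0.
have As s : s \in `[0%R, t]%classic -> A s.
  by rewrite inE /= in_itv/= => /(A_down At).
pose E : set spacetime := D `&` fst @^-1` `[0%R, t]%classic.
have mfst (i : interval R) : measurable (fst @^-1` [set` i] : set spacetime).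
  rewrite -[_ @^-1` _]setTI.
  exact: (@measurable_fst _ _ (measurableTypeR R) (borelRV R d)
    measurableT _ (measurable_itv _)).
have mE' : measurable E by exact: measurableI.
have ED : E `<=` D by move=> w [].
pose g (w : spacetime) := generator ut ux b (Y w, w.1).
have mg : measurable_fun E g.
  apply: measurable_funS (mfst `[0%R, T[) _
    (measurable_flow A_ge0 A_down generator_continuous).
  by move=> w [_ /= wt]; apply: As; rewrite inE.
have [M HM] := slab_fun_bound tT generator_continuous (generator0 su u0 b).
have gM w : E w -> (`|g w| <= M)%R.
  by move=> [_ /= wt]; apply: HM; move: wt; rewrite in_itv.
have ig := integrable_product mE' ED mg gM.
have [Mu HMu] := slab_fun_bound tT (slab_cont su) u0.
have iu : nu.-integrable setT (fun x : borelRV R d => (u (x, 0%R))%:E).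
  apply: measurable_bounded_integrable => //; first exact: fin_num_fun_lty.
    apply: (measurable_time_section A_ge0 A_down (slab_cont su)).
    by apply: A_down At _; rewrite lexx.
  exists Mu; split; first exact: num_real.
  by move=> N MN x _ /=; apply: le_trans (ltW MN); apply: HMu; rewrite lexx.
rewrite integral_mu//; last first.
  by apply/measurable_EFinP; exact: (measurable_time_section A_ge0 A_down (slab_cont su)).
transitivity (\int[nu]_x ((u (x, 0%R))%:E +
    \int[leb]_s ((EFin \o g) \_ E) (s, x))).
  apply: eq_integral => x _; rewrite preimage_setT setIT.
  transitivity ((along [set s | D (s, x)] (fun s => Y (s, x)) u t)%:E).
    rewrite patchE /along; case: ifPn; rewrite ?inE ?notin_setE => h.
      by rewrite mem_set.
    by rewrite memNset.
  rewrite Hpath integral_mkcond; congr (_ + _); apply: eq_integral => s _.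
  rewrite !patchE; case: ifPn => st.
    rewrite /along; have [Ds|nDs] := pselect (D (s, x)).
      by rewrite !mem_set//; split => //; move: st; rewrite inE.
    by rewrite !memNset// => -[].
  by rewrite memNset// => -[_ /= st']; move: st; rewrite notin_setE.
rewrite integralD//; last exact: (integrable_marginal2 ig).
congr (_ + _); rewrite -(Fubini ig) [RHS]integral_mkcond.
apply: eq_integral => s _; rewrite patchE; case: ifPn => st.
  rewrite integral_mu//; last first.
    apply/measurable_EFinP.
    exact: (measurable_time_section A_ge0 A_down generator_continuous (As _ st)).
  apply: eq_integral => x _; rewrite !patchE preimage_setT setIT.
  have [Ds|nDs] := pselect (D (s, x)).
    by rewrite !mem_set//; split => //; move: st; rewrite inE.
  by rewrite !memNset// => -[].
apply: integral0_eq => x _; rewrite patchE memNset// => -[_ /= st'].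
by move: st; rewrite notin_setE.
Qed.

End Cauchy.

(** The majorant [W] depends on the starting point alone, so pulling back to [nu] bounds the inner
    integral by the same constant at every time. *)
Lemma integral_mu_le (F : 'rV[R]_d * R -> R) (V : 'rV[R]_d -> R)
    (W : borelRV R d -> \bar R) (B : set (borelRV R d)) (c w : R) :
  {within setT `*` `[0%R, T], continuous F} -> measurable B ->
  (0 <= c)%R -> (forall x, (0 <= V x)%R) ->
  (forall x t, B x -> (0 <= t <= T)%R -> (0 <= F (x, t) <= c * (1 + V x))%R) ->
  measurable_fun setT W -> (forall x, 0 <= W x) -> \int[nu]_x W x <= w%:E ->
  (forall t x, D (t, x) -> (V (Y (t, x)))%:E <= W x) ->
  0 <= \int[leb]_(t in `[0%R, T]) \int[mu t]_(x in B) (F (x, t))%:E <=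
    (c * (T * (fine (nu setT) + w)))%:E.
Proof.
move=> cF mB c0 V0 FB mW W0 Ww VW.
pose A : set R := `[0%R, T]%classic.
have A0 t : A t -> (0 <= t)%R by rewrite /A /= in_itv/= => /andP[].
have Ad a t : A t -> (0 <= a <= t)%R -> A a.
  rewrite /A /= !in_itv/= => /andP[_ tT] /andP[-> /le_trans]; exact.
pose E := D `&` Y @^-1` B.
have mE' : measurable E by exact: measurable_killed_preimage.
have EA : E `<=` fst @^-1` A by move=> [t x] [/D_T tT _]; rewrite /A /= in_itv.
pose f := (fun w : spacetime => (F (Y w, w.1))%:E) \_ E.
have f0 z : 0 <= f z.
  rewrite /f patchE; case: ifPn => //; case: z => t x; rewrite inE => -[Dtx Bx].
  by rewrite lee_fin; have /andP[] := FB _ _ Bx (D_T Dtx).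
have mf : measurable_fun setT f.
  apply/(measurable_restrictT _ mE'); apply/measurable_EFinP.
  apply: measurable_funS EA (measurable_flow A0 Ad cF).
  rewrite -[_ @^-1` _]setTI.
  exact: (@measurable_fst _ _ (measurableTypeR R) (borelRV R d)
    measurableT _ (measurable_itv _)).
have muF t : t \in `[0%R, T]%classic ->
    \int[mu t]_(x in B) (F (x, t))%:E = \int[nu]_x f (t, x).
  rewrite inE => tA; apply: integral_mu => //.
  apply/measurable_EFinP; apply: measurable_funTS.
  exact: (measurable_time_section A0 Ad cF tA).
have -> : \int[leb]_(t in `[0%R, T]) \int[mu t]_(x in B) (F (x, t))%:E =
    \int[leb]_(t in `[0%R, T]) \int[nu]_x f (t, x).
  by apply: eq_integral => t tT; exact: muF.
have mG : measurable_fun setT (fun t => \int[nu]_x f (t, x)).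
  exact: (measurable_fun_fubini_tonelli_F f).
have G_le t : \int[nu]_x f (t, x) <= c%:E * (nu setT + w%:E).
  apply: (@le_trans _ _ (\int[nu]_x (c%:E * (1 + W x)))); last first.
    rewrite ge0_integralZl//; last 2 first.
    - exact: emeasurable_funD.
    - by move=> x _; rewrite adde_ge0.
    rewrite ge0_integralD// integral_cst// mul1e.
    by apply: lee_wpmul2l; rewrite ?lee_fin// leeD2l.
  apply: ge0_le_integral => //.
  - exact: measurableT_comp mf (pair1_measurable t).
  - by apply: emeasurable_funM => //; exact: emeasurable_funD.
  - move=> x _; rewrite /f patchE; case: ifPn; last first.
      by move=> _; rewrite mule_ge0// adde_ge0.
    rewrite inE => -[Dtx Bx]; have /andP[_ h] := FB _ _ Bx (D_T Dtx).
    apply: (@le_trans _ _ (c * (1 + V (Y (t, x))))%:E); first by rewrite lee_fin.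
    by rewrite EFinM lee_wpmul2l ?lee_fin// EFinD leeD2l// VW.
apply/andP; split; first by apply: integral_ge0 => t _; exact: integral_ge0.
apply: (@le_trans _ _ (\int[leb]_(t in `[0%R, T]) (cst (c%:E * (nu setT + w%:E)) t))).
  apply: ge0_le_integral => //.
  - by move=> t _; exact: integral_ge0.
  - exact: measurable_funTS mG.
rewrite integral_cst//= lebesgue_measure_itv/= lte_fin T_gt0 sube0.
rewrite -[nu setT](fineK (fin_num_measure nu _ measurableT)) -EFinD -!EFinM lee_fin /=.
by rewrite -mulrA [X in (_ * X <= _)%R]mulrC.
Qed.

End Transport.

(** * Translation of the hypotheses from the Euclidean to the sup norm *)

Section Hypotheses.
Context {R : realType} {d : nat}.

Lemma enorm_continuous : continuous (@enorm R d).
Proof.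
move=> x; have Hx := nbhs_filter x.
apply: (@continuous_comp _ _ _ (fun y : 'rV[R]_d => dotr y y) Num.sqrt).
  by apply: (@cvg_dotr _ _ _ _ Hx); exact: cvg_id.
exact: sqrt_continuous.
Qed.

Lemma measurable_eball (a : 'rV[R]_d) (r : R) :
  measurable (eball a r : set (borelRV R d)).
Proof.
apply: open_borel.
apply: (@open_comp 'rV[R]_d R (fun x => enorm (x - a)) [set y | y < r]);
  last exact: open_lt.
move=> x _; apply: (@continuous_comp 'rV[R]_d 'rV[R]_d R (fun x => x - a) enorm).
  have Hx := nbhs_filter x.
  by apply: (@cvgB _ _ _ _ Hx); [exact: cvg_id|exact: (@cvg_cst _ _ _ _ Hx)].
exact: enorm_continuous.
Qed.

Lemma eball_bounded (a x : 'rV[R]_d) (r : R) : eball a r x -> `|x| <= `|a| + r.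
Proof.
rewrite /eball /= => xr; rewrite -(subrK a x) addrC.
apply: le_trans (ler_normD _ _) _; rewrite lerD2l.
exact: le_trans (norm_le_enorm _) (ltW xr).
Qed.

Lemma norm_le_eball (x : 'rV[R]_d) (N : R) : `|x| <= N -> eball 0 (d%:R * N + 1) x.
Proof.
move=> xN; rewrite /eball /= subr0; apply: le_lt_trans (enorm_le x) _.
by rewrite ltr_pwDr// ler_wpM2l.
Qed.

Lemma linear_growth (f : 'rV[R]_d * R -> 'rV[R]_d) (T : R) :
  [bounded (1 + enorm z.1)^-1 * enorm (f z)
     | z in [set z : 'rV[R]_d * R | 0 <= z.2 <= T]] ->
  exists G, forall x t, 0 <= t <= T -> `|f (x, t)| <= G * (1 + `|x|).
Proof.
move=> [M [_ HM]]; exists ((`|M| + 1) * (1 + d%:R)) => x t tT.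
have MM : M < `|M| + 1 by rewrite (le_lt_trans (ler_norm M))// ltrDl.
have := HM _ MM (x, t) tT; rewrite /=.
have e0 : 0 < 1 + enorm x by rewrite ltr_wpDr// sqrtr_ge0.
rewrite ger0_norm ?mulr_ge0 ?invr_ge0 ?sqrtr_ge0// ?(ltW e0)//.
rewrite mulrC ler_pdivrMr// => h.
apply: le_trans (norm_le_enorm _) _; apply: le_trans h _.
rewrite -mulrA ler_wpM2l ?addr_ge0//.
rewrite mulrDl mul1r mulrDr mulr1 -addrA lerD2l.
have := enorm_le x; have : 0 <= d%:R :> R by []; have := normr_ge0 x.
lra.
Qed.

Lemma uniform_eventually (V W : normedModType R) (A : set V)
    (F : nat -> V -> W) (f : V -> W) :
  {uniform A, F @ \oo --> f} -> forall e, 0 < e ->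
  \forall k \near \oo, forall z, A z -> `|f z - F k z| < e.
Proof.
move=> Ff e e0; apply: (Ff [set g | forall z, A z -> `|f z - g z| < e]).
rewrite uniform_nbhs; exists [set xy | ball xy.1 e xy.2]; split.
  exact: (entourage_ball _ (PosNum e0)).
by move=> g /= H z Az; have := H z Az; rewrite -ball_normE.
Qed.

End Hypotheses.

(** * Lower limits of extended real sequences and functions *)

Section LimInf.
Context {R : realType}.
Implicit Types (u : nat -> \bar R) (c : \bar R).
Local Open Scope ereal_scope.

Lemma limn_einf_le u c : (forall n, u n <= c) -> limn_einf u <= c.
Proof.
move=> uc; rewrite limn_einf_lim; apply: lime_le; first exact: is_cvg_einfs.
apply: nearW => n; apply: le_trans (uc n).
by apply: ereal_inf_lbound; exists n => /=.
Qed.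

Lemma le_limn_einf u c m : (forall n, (m <= n)%N -> c <= u n) -> c <= limn_einf u.
Proof.
move=> cu; rewrite limn_einf_lim; apply: lime_ge; first exact: is_cvg_einfs.
exists m => // n /= mn; apply: le_ereal_inf_tmp => _ [k /= nk <-].
by apply: cu; exact: leq_trans nk.
Qed.

Context d (X : measurableType d).

Lemma measurable_limn_einf (f : nat -> X -> \bar R) :
  (forall n, measurable_fun setT (f n)) ->
  measurable_fun setT (fun x => limn_einf (fun n => f n x)).
Proof.
move=> mf; apply: (emeasurable_fun_cvg (fun n x => einfs (fun k => f k x) n)) => [n|x _].
  exact: measurable_fun_einfs.
by rewrite limn_einf_lim; exact: is_cvg_einfs.
Qed.

End LimInf.

Theorem proposition2p8 (R : realType) (d : nat) (T : R) (T_gt0 : 0 < T)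
    (b : 'rV[R]_d * R -> 'rV[R]_d)
    (b_cont : {within setT `*` `[0, T], continuous b})
    (bk : nat -> 'rV[R]_d * R -> 'rV[R]_d)
    (Vk : nat -> 'rV[R]_d -> R)
    (bk_smooth : forall k, smooth_spacetime (bk k))
    (Vk_C1 : forall k, C1_space (Vk k))
    (Vk_gt0 : forall k x, 0 < Vk k x)
    (hyp_i : exists C1 C2 C3 : R,
      (forall k m, (k <= m)%N -> forall x, Vk k x <= C1 * Vk m x + C2) /\
      (forall k (x : 'rV[R]_d) (t : R), 0 <= t <= T ->
        dotr (bk k (x, t)) (grad (Vk k) x) <= C3 * Vk k x))
    (hyp_ii_growth : forall k,
      [bounded (1 + enorm z.1)^-1 * enorm (bk k z)
        | z in [set z : 'rV[R]_d * R | 0 <= z.2 <= T]])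
    (hyp_ii_cvg : forall (a : 'rV[R]_d) (r : R),
      {uniform eball a r `*` `[0, T], bk @ \oo --> b})
    (nu : {finite_measure set (borelRV R d) -> \bar R})
    (sup_Vk : (ereal_sup (range (fun k => 'N[nu]_1[EFin \o Vk k])) < +oo)%E) :
  exists mu : R -> {finite_measure set (borelRV R d) -> \bar R},
    solves_cauchy T b nu mu /\
    (forall (a : 'rV[R]_d) (r : R),
      (\int[lebesgue_measure]_(t in `[0%R, T])
         \int[mu t]_(x in eball a r)
           (enorm (b (x, t) - bk k (x, t)) * Num.sqrt (Vk k x))%:E)%E
        @[k --> \oo] --> 0%E).
Proof.
have [C1 [C2 [C3 [HC HL]]]] := hyp_i.
have bc k : continuous (bk k) by have [] := bk_smooth k 0%N.
(* The constants may be negative; positivity of [Vk] allows replacing them by their absolute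
   values. *)
have HC' k m : (k <= m)%N -> forall x, Vk k x <= `|C1| * Vk m x + `|C2|.
  move=> km x; apply: le_trans (HC k m km x) _.
  by rewrite lerD ?ler_norm// ler_wpM2r ?ler_norm// ltW.
have Hcvg N e : 0 < e -> \forall k \near \oo, forall x t, `|x| <= N -> 0 <= t <= T ->
    `|b (x, t) - bk k (x, t)| < e.
  move=> e0; apply: filterS (uniform_eventually (hyp_ii_cvg 0 (d%:R * N + 1)) e0).
  move=> k H x t xN tT; apply: H; split => /=; last by rewrite in_itv.
  exact: norm_le_eball.
have [D [Y [mD mY DT [al [be [al0 be0 HV]]] Hid]]] := limit_flow T_gt0 b_cont bc
  Vk_C1 Vk_gt0 (normr_ge0 C1) (normr_ge0 C2) HC' HL
  (fun k => linear_growth (hyp_ii_growth k)) Hcvg.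
have mslice t : measurable ([set x | D (t, x)] : set (borelRV R d)).
  rewrite -[X in measurable X]setTI.
  exact: (@pair1_measurable _ _ (measurableTypeR R) (borelRV R d) t measurableT _ mD).
have mYt t : measurable_fun setT (fun x => Y (t, x)).
  exact: (measurableT_comp mY (pair1_measurable t)).
have [mu muE] := choice (fun t => killed_pushforward_finite_measure (mslice t) (mYt t)
  (fin_num_measure nu)).
have mpsi : measurable_fun setT
    (fun w : measurableTypeR R * borelRV R d => (Y w, w.1)).
  by apply: measurable_fun_pair => //; exact: measurable_fst.
have [m mE] := killed_pushforward_measure (lebesgue_measure \x nu)%E mD mpsi.
exists mu; split.
  split.
  - exact: (admissible_mu T mD mY muE).
  - exists m; split; first exact: (given_by_mu mD mY DT muE mE).
    move=> a r i.
    have [M M0 HM] := compact_bound (@compact_slab R d (`|a| + r) 0 T)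
      (continuous_subspaceW
        (fun z (Hz : ([set x : 'rV[R]_d | `|x| <= `|a| + r] `*` `[0, T]) z) =>
          conj I Hz.2) b_cont).
    apply: (integrable_slab (b := fun z => b z 0 i) (M := M) mD mY DT mE).
    + by move=> z; apply: cvg_coord; exact: b_cont.
    + exact: measurable_eball.
    + move=> x t Bx tT; apply: le_trans (coord_le_norm _ _) _; apply: HM.
      by split => /=; [exact: eball_bounded Bx|rewrite in_itv].
  - move=> u ut ux su [r ur].
    have u0 x t : 0 <= t < T -> r < `|x| -> u (x, t) = 0.
      by move=> tT rx; apply: ur => //; apply: lt_le_trans rx _; exact: norm_le_enorm.
    (* One exceptional time serves all test functions: at [T] the test function itself is
       unconstrained. *)
    exists [set T]; split; first exact: measurable_set1.
      exact: lebesgue_measure_set1.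
    move=> t /= Ht; apply: contrapT => tT'; apply: Ht => /andP[t0 tT].
    have {}tT : 0 <= t < T by rewrite t0 lt_neqAle tT andbT; apply/eqP.
    exact: (cauchy_mu mD mY DT muE b_cont su u0 tT
      (fun x => Hid u ut ux r su u0 x t tT)).
move=> a r.
pose J k := (\int[lebesgue_measure]_(t in `[0%R, T])
  \int[mu t]_(x in eball a r) (enorm (b (x, t) - bk k (x, t)) * Num.sqrt (Vk k x))%:E)%E.
rewrite -/(J _).
have [M M0 HM] : exists2 M : R, 0 <= M & forall k, (\int[nu]_x (Vk k x)%:E <= M%:E)%E.
  exists (fine (ereal_sup (range (fun k => 'N[nu]_1[EFin \o Vk k])))%E).
    apply: fine_ge0; apply: (le_trans (Lnorm_ge0 nu 1 (EFin \o Vk 0%N))).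
    by apply: ereal_sup_ubound; exists 0%N.
  move=> k.
  have Nk : ('N[nu]_1[EFin \o Vk k] <=
      ereal_sup (range (fun k => 'N[nu]_1[EFin \o Vk k])))%E.
    by apply: ereal_sup_ubound; exists k.
  rewrite fineK; last first.
    by rewrite ge0_fin_numE//; apply: le_trans Nk; exact: Lnorm_ge0.
  apply: le_trans Nk; rewrite Lnorm1 le_eqVlt; apply/orP; left; apply/eqP.
  by apply: eq_integral => x _; rewrite /= ger0_norm// ltW.
(* This dominates every [Vk k] along the path from [x], since the Lyapunov bound holds for all large
   [l]. *)
pose W (x : borelRV R d) := limn_einf (fun l => (al * Vk l x + be)%:E).
have mVk l : measurable_fun setT (fun x : borelRV R d => Vk l x).
  by apply: continuous_borel_real; exact: C1_space_continuous.
have mW' l : measurable_fun setT (fun x : borelRV R d => (al * Vk l x + be)%:E).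
  apply/measurable_EFinP; apply: measurable_funD => //; exact: measurable_funM.
have W'0 l (x : borelRV R d) : (0 <= (al * Vk l x + be)%:E)%E.
  by rewrite lee_fin addr_ge0// mulr_ge0// ltW.
have mW : measurable_fun setT W by exact: measurable_limn_einf.
have W0 x : (0 <= W x)%E by apply: (@le_limn_einf _ _ _ 0%N).
pose w := al * M + be * fine (nu setT).
have Ww : (\int[nu]_x W x <= w%:E)%E.
  apply: le_trans (fatou nu measurableT mW' (fun n x _ => W'0 n x)) _.
  apply: limn_einf_le => l; under eq_integral do rewrite EFinD EFinM.
  rewrite ge0_integralD//; first last.
  - by apply/measurable_EFinP; exact: measurable_funM.
  - by move=> x _; rewrite -EFinM lee_fin mulr_ge0// ltW.
  rewrite ge0_integralZl//; first last.
  - by move=> x _; rewrite lee_fin ltW.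
  - exact/measurable_EFinP.
  rewrite integral_cst// /w EFinD !EFinM fineK ?fin_num_measure// leeD//.
  by rewrite lee_wpmul2l ?lee_fin.
pose Q := T * (fine (nu setT) + w).
have Q0 : 0 <= Q.
  by rewrite mulr_ge0 ?(ltW T_gt0)// addr_ge0 ?fine_ge0// addr_ge0 ?mulr_ge0 ?fine_ge0.
(* On the ball the field difference is eventually below [e] in sup norm, hence at most [d * e] in
   Euclidean norm; [Q] bounds the time integral of [1 + Vk k] for all [k]. *)
have HJ e : 0 < e -> \forall k \near \oo, (0 <= J k <= (d%:R * e * Q)%:E)%E.
  move=> e0; apply: filterS (Hcvg (`|a| + r) e e0) => k Hk.
  pose F (z : 'rV[R]_d * R) := enorm (b z - bk k z) * Num.sqrt (Vk k z.1).
  apply: (integral_mu_le (F := F) (V := Vk k) (W := W) (B := eball a r)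
    (c := d%:R * e) (w := w) T_gt0 mD mY DT muE) => //.
  - move=> z; apply: cvgM.
      apply: continuous_cvg; first exact: enorm_continuous.
      apply: cvgB; first exact: b_cont.
      exact: (continuous_subspaceT (bc k)).
    apply: continuous_cvg; first exact: sqrt_continuous.
    apply: (@continuous_subspaceT _ _ _ (fun z : 'rV[R]_d * R => Vk k z.1)) => y.
    apply: (@continuous_comp _ _ _ fst (Vk k)); first exact: cvg_fst.
    exact: C1_space_continuous.
  - exact: measurable_eball.
  - by rewrite mulr_ge0// ltW.
  - by move=> x; exact: ltW.
  - move=> x t Bx tT; rewrite mulr_ge0 ?sqrtr_ge0//= ler_pM ?sqrtr_ge0//.
      apply: le_trans (enorm_le _) _; rewrite ler_wpM2l// ltW//.
      by apply: Hk => //; exact: eball_bounded Bx.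
    have V0 := Vk_gt0 k x; have V1 : 0 <= 1 + Vk k x by lra.
    rewrite -[leRHS](ger0_norm V1) -sqrtr_sqr ler_sqrt ?sqr_ge0//; nra.
  - move=> t x Dtx; have [l0 Hl] := HV t x Dtx k.
    by apply: (@le_limn_einf _ _ _ l0) => l /Hl; rewrite lee_fin.
apply/fine_cvgP; split.
  apply: filterS (HJ 1 ltr01) => k /andP[J0 J1].
  by rewrite ge0_fin_numE// (le_lt_trans J1)// ltry.
apply/cvgrPdist_le => e e0.
(* The added 1 avoids a division by zero when [d] or [Q] vanishes. *)
have q0 : 0 < d%:R * Q + 1 by rewrite ltr_wpDl// mulr_ge0.
apply: filterS (HJ (e / (d%:R * Q + 1)) (divr_gt0 e0 q0)) => k /andP[J0 J1].
rewrite sub0r normrN ger0_norm ?fine_ge0//.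
have : fine (J k) <= d%:R * (e / (d%:R * Q + 1)) * Q.
  by rewrite -lee_fin fineK// ge0_fin_numE// (le_lt_trans J1)// ltry.
move=> /le_trans; apply.
rewrite mulrAC mulrA ler_pdivrMr// mulrC ler_pM2l//; lra.
Qed.
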